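(* Let $A$ and $B$ be quasi-unital bornological algebras and let $f\colon A\to B$ be a proper morphism. Then the natural maps $$\mathrm{Ess}_A(f^*M)=A\hat\otimes_A M\to B\hat\otimes_B M=f^*(\mathrm{Ess}_B M),$$ $$f^*(\mathrm{Rgh}_B M)=\mathrm{Hom}_B(B,M)\to\mathrm{Hom}_A(A,f^*M)=\mathrm{Rgh}_A f^*(M)$$ induced by $f\colon A\to B$ are bornological isomorphisms for all $M\in\mathrm{Mod}(B^+)$. Therefore, $f^!=f^*$ as functors $\mathrm{Mod}(B)\to\mathrm{Mod}(A)$.
   Context: All bornological vector spaces are complete and convex over $\mathbb C$ (every bounded subset is contained in a bounded absolutely convex $T$ whose span $V_T$ is a Banach space with closed unit ball $T$). $\hat\otimes$ is the complete bornological tensor product (universal for bounded bilinear maps). For a bornological algebra $A$ (bounded associative multiplication, possibly non-unital), with unitisation $A^+$, $\mathrm{Mod}(A^+)$ is the category of all bornological left $A$-modules. $\mathrm{Hom}_A(M,N)$ is the space of bounded $A$-module homomorphisms with the equibounded bornology; $M\hat\otimes_A N$ is the quotient of $M\hat\otimes N$ by the closure of the span of the elements $ma\otimes n-m\otimes an$. $A$ is quasi-unital if for each bounded $S\subseteq A$ there is a sequence $(u_n)$ in $A$ with $u_nx\to x$, $xu_n\to x$ uniformly for $x\in S$ (in some $A_T$), and $A$ is projective as a left and as a right $A$-module relative to extensions with a bounded linear section (equivalently, $A^+\hat\otimes A\to A$ and $A\hat\otimes A^+\to A$ have bounded left, respectively right, $A$-module sections). A module $M$ is essential if $A\hat\otimes_A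 M\to M$ is a bornological isomorphism; $\mathrm{Mod}(A)$ is the full subcategory of essential modules in $\mathrm{Mod}(A^+)$. For $M\in\mathrm{Mod}(A^+)$, $\mathrm{Ess}_A(M)=A\hat\otimes_A M$ and $\mathrm{Rgh}_A(M)=\mathrm{Hom}_A(A,M)$ with $(af)(x)=f(xa)$. A proper morphism $f\colon A\to B$ is a bounded algebra homomorphism $A\to B$ such that $B$ is an essential $A$-bimodule via $f$. $f^*\colon\mathrm{Mod}(B^+)\to\mathrm{Mod}(A^+)$ is restriction of the module structure along $f$; it maps $\mathrm{Mod}(B)$ into $\mathrm{Mod}(A)$. The functor $f^!\colon\mathrm{Mod}(B)\to\mathrm{Mod}(A)$ is $f^!(M)=\mathrm{Ess}_A\mathrm{Hom}_B(B,M)$, with $A$ acting on $\mathrm{Hom}_B(B,M)$ through its right action on $B$. The equality $f^!=f^*$ means canonical natural isomorphism. *)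

(* Defs.v *)
From HB Require Import structures.
From mathcomp Require Import all_boot all_order all_algebra.
From mathcomp Require Import all_classical reals.
From mathcomp Require Import complex ring lra.
Set Implicit Arguments.
Unset Strict Implicit.
Unset Printing Implicit Defensive.
Import Order.TTheory GRing.Theory Num.Theory Normc.
Local Open Scope classical_set_scope.
Local Open Scope ring_scope.
Local Open Scope complex_scope.

Section Disks.
Variables (R : realType) (V : lmodType R[i]).
Implicit Types (T W X : set V) (r e : R).

Definition is_subspace W :=
  W 0 /\ forall (c : R[i]) x y, W x -> W y -> W (c *: x + y).

Definition lin_span X : set V :=
  [set x | forall W, is_subspace W -> X `<=` W -> W x].

Definition abs_convex T :=
  T 0 /\ forall (a b : R[i]) x y,
    normc a + normc b <= 1 -> T x -> T y -> T (a *: x + b *: y).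

Definition is_norm_on W (N : V -> R) :=
  [/\ forall x, W x -> 0 <= N x,
      forall x, W x -> N x = 0 -> x = 0,
      forall (c : R[i]) x, W x -> N (c *: x) = normc c * N x
    & forall x y, W x -> W y -> N (x + y) <= N x + N y].

Definition is_complete_norm_on W (N : V -> R) :=
  forall u : nat -> V, (forall n, W (u n)) ->
  (forall e, 0 < e -> exists n0, forall m n, (n0 <= m)%N -> (n0 <= n)%N ->
     N (u m - u n) <= e) ->
  exists2 x, W x & forall e, 0 < e -> exists n0, forall n, (n0 <= n)%N ->
     N (u n - x) <= e.

Definition complete_disk T :=
  abs_convex T /\ exists N : V -> R,
    [/\ is_norm_on (lin_span T) N, is_complete_norm_on (lin_span T) N
      & T = [set x | lin_span T x /\ N x <= 1]].

(* For a complete disk [T] and [r > 0] this is the closed ball of radius [r] of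
   the Banach space spanned by [T]. *)
Definition dil r T : set V := [set r%:C *: x | x in T].

Lemma normcR r : normc r%:C = `|r|.
Proof. by rewrite /normc /= expr0n /= addr0 sqrtr_sqr. Qed.

Lemma normc_ge0 (c : R[i]) : 0 <= normc c.
Proof. by case: c => a b; rewrite /normc sqrtr_ge0. Qed.

Lemma dil1 T : dil 1 T = T.
Proof.
apply/seteqP; split=> [_ [x Tx <-]|x Tx]; first by rewrite scale1r.
by exists x => //; rewrite scale1r.
Qed.

Lemma dil_dil a b T : dil a (dil b T) = dil (a * b) T.
Proof.
apply/seteqP; split=> [_ [_ [x Tx <-] <-]|_ [x Tx <-]].
  by exists x => //; rewrite scalerA rmorphM.
by exists (b%:C *: x); [exists x|rewrite scalerA rmorphM].
Qed.

Lemma dil_mono r T T' : T `<=` T' -> dil r T `<=` dil r T'.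
Proof. by move=> h _ [x Tx <-]; exists x => //; exact: h. Qed.

Section ac.
Variables (T : set V) (acT : abs_convex T).

Lemma ac0 : T 0. Proof. by case: acT. Qed.

Lemma dil0 r : dil r T 0.
Proof. by exists 0; rewrite ?scaler0//; exact: ac0. Qed.

Lemma acZ (c : R[i]) x : normc c <= 1 -> T x -> T (c *: x).
Proof.
move=> c1 Tx; have := (proj2 acT) c 0 x 0.
by rewrite normc0 addr0 scaler0 addr0; apply => //; exact: ac0.
Qed.

Lemma dil_inv r x : 0 < r -> dil r T x <-> T (r^-1%:C *: x).
Proof.
move=> r0; have rn : r != 0 by rewrite gt_eqF.
split=> [[y Ty <-]|Tx]; last first.
  by exists (r^-1%:C *: x) => //; rewrite scalerA -rmorphM /= divff// scale1r.
by rewrite scalerA -rmorphM /= mulVf// scale1r.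
Qed.

Lemma dilZ (c : R[i]) r s x : 0 <= r -> normc c * r <= s -> dil r T x ->
  dil s T (c *: x).
Proof.
move=> r0 crs [y Ty <-].
have s0 : 0 <= s by apply: le_trans crs; rewrite mulr_ge0 ?normc_ge0.
have [s00|sn0] := eqVneq s 0.
  have : normc c * r = 0.
    by apply/eqP; rewrite eq_le mulr_ge0 ?normc_ge0// andbT -s00.
  move=> /eqP; rewrite mulf_eq0 => /orP[|] /eqP h.
    by rewrite (eq0_normc h) scale0r; exact: dil0.
  by rewrite h scale0r scaler0; exact: dil0.
have sp : 0 < s by rewrite lt_def sn0.
apply/dil_inv => //; rewrite !scalerA; apply: acZ => //.
rewrite !normcM !normcR ger0_norm ?invr_ge0// (ger0_norm r0).
by rewrite -mulrA ler_pdivrMl// mulr1.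
Qed.

Lemma dil_le r s : 0 <= r -> r <= s -> dil r T `<=` dil s T.
Proof. by move=> r0 rs x /(@dilZ 1 r s) ; rewrite normc1 mul1r scale1r; exact. Qed.

Lemma dilN r x : 0 <= r -> dil r T x -> dil r T (- x).
Proof.
move=> r0 h; rewrite -scaleN1r; apply: (dilZ r0 _ h).
by rewrite normcN normc1 mul1r.
Qed.

Lemma dilD r s x y : 0 <= r -> 0 <= s -> dil r T x -> dil s T y ->
  dil (r + s) T (x + y).
Proof.
move=> r0 s0 hx hy; have [rs|rs] := eqVneq (r + s) 0.
  have r00 : r = 0.
    by apply/eqP; rewrite eq_le r0 andbT -rs lerDl.
  have s00 : s = 0 by rewrite -rs r00 add0r.
  move: hx hy => [x' _ <-] [y' _ <-].
  by rewrite r00 s00 !scale0r !addr0; exact: dil0.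
have rsp : 0 < r + s by rewrite lt_def rs addr_ge0.
move: hx hy => [x' Tx <-] [y' Ty <-].
apply/dil_inv => //; rewrite scalerDr !scalerA; apply: (proj2 acT) => //.
rewrite -!rmorphM !normcR !ger0_norm ?mulr_ge0 ?invr_ge0 ?(ltW rsp)//.
by rewrite -mulrDr mulVf.
Qed.

Lemma dilB r s x y : 0 <= r -> 0 <= s -> dil r T x -> dil s T y ->
  dil (r + s) T (x - y).
Proof. by move=> r0 s0 hx hy; apply: dilD => //; exact: dilN. Qed.

Lemma dil_sum (I : Type) (s : seq I) (c : I -> R) (F : I -> V) :
  (forall i, 0 <= c i) -> (forall i, dil (c i) T (F i)) ->
  dil (\sum_(i <- s) c i) T (\sum_(i <- s) F i).
Proof.
move=> c0 h; elim: s => [|a s IH]; first by rewrite !big_nil; exact: dil0.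
rewrite !big_cons; apply: dilD => //; exact: sumr_ge0.
Qed.

Lemma abs_convex_dil r : 0 <= r -> abs_convex (dil r T).
Proof.
move=> r0; split; first exact: dil0.
move=> a b x y ab hx hy.
apply: (@dil_le (normc a * r + normc b * r)).
- by rewrite addr_ge0 ?mulr_ge0 ?normc_ge0.
- by rewrite -mulrDl ler_piMl.
- apply: dilD; rewrite ?mulr_ge0 ?normc_ge0//.
    exact: (dilZ r0 _ hx).
  exact: (dilZ r0 _ hy).
Qed.

Lemma spanE x : lin_span T x <-> exists2 r, 0 < r & dil r T x.
Proof.
split=> [h|[r r0 [y Ty <-]] W [W0 WD] TW]; last first.
  have := WD r%:C y 0; rewrite addr0; apply => //; exact: TW.
apply: (h [set x | exists2 r, 0 < r & dil r T x]); last first.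
  by move=> y Ty; exists 1 => //; rewrite dil1.
split; first by exists 1 => //; exact: dil0.
move=> c y z [r r0 hy] [s s0 hz]; exists (normc c * r + s).
  by rewrite ltr_wpDl ?mulr_ge0 ?normc_ge0// ltW.
by apply: dilD; rewrite ?mulr_ge0 ?normc_ge0 ?ltW//; apply: dilZ hy; rewrite // ltW.
Qed.
End ac.

(* A characterisation of complete disks that does not mention the norm. *)
Record disk_spec T : Prop := DiskSpec {
  ds_ac : abs_convex T;
  ds_sep : forall x, (forall e, 0 < e -> dil e T x) -> x = 0;
  ds_closed : forall x, (forall e, 0 < e -> dil (1 + e) T x) -> T x;
  ds_complete : forall u : nat -> V,
    (forall e, 0 < e -> exists n0, forall m n, (n0 <= m)%N -> (n0 <= n)%N ->
       dil e T (u m - u n)) ->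
    exists x, forall e, 0 < e -> exists n0, forall n, (n0 <= n)%N ->
       dil e T (u n - x) }.

Lemma complete_disk_spec T : complete_disk T -> disk_spec T.
Proof.
move=> [acT [N [[N0 Ni NZ ND] NC TE]]].
have dilE e x : 0 < e -> dil e T x <-> lin_span T x /\ N x <= e.
  move=> e0; have en : e != 0 by rewrite gt_eqF.
  split=> [h|[hx Nx]].
    have hx : lin_span T x by apply/(spanE acT); exists e.
    split => //; case: h => y; rewrite {1}TE => -[hy Ny] <-.
    by rewrite NZ// normcR gtr0_norm// ger_pMr.
  apply/(dil_inv _ _ e0); rewrite TE; split.
    apply/(spanE acT); move/(spanE acT) : hx => [r r0 hr].
    exists (e^-1 * r); first by rewrite mulr_gt0 ?invr_gt0.
    apply: (dilZ acT _ _ hr); first exact: ltW.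
    by rewrite normcR gtr0_norm ?invr_gt0.
  by rewrite NZ// normcR gtr0_norm ?invr_gt0// ler_pdivrMl// mulr1.
split => //.
- move=> x h; have /dilE[//|hx _] := h 1 ltr01.
  apply: Ni => //; apply/eqP; rewrite eq_le N0// andbT.
  by apply/ler_addgt0Pr => e e0; rewrite add0r; case/dilE : (h e e0).
- move=> x h; have h1 e (e0 : 0 < e) : lin_span T x /\ N x <= 1 + e.
    by apply/dilE => //; [rewrite addr_gt0|exact: h].
  rewrite TE; split; first by case: (h1 1 ltr01).
  by apply/ler_addgt0Pr => e /h1[].
- move=> u Cu; have [n1 h1] := Cu 1 ltr01.
  pose v n := u (n + n1)%N - u n1.
  have vS n : lin_span T (v n).
    by apply/(spanE acT); exists 1 => //; apply: h1; rewrite ?leq_addl.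
  have [e e0|x hx xP] := NC v vS.
    have [n0 h0] := Cu e e0; exists n0 => m n mn nn.
    have -> : v m - v n = u (m + n1)%N - u (n + n1)%N.
      by rewrite /v opprB addrA subrK.
    have /dilE[//|_ //] : dil e T (u (m + n1)%N - u (n + n1)%N).
    by apply: h0; apply: leq_trans (leq_addr _ _).
  exists (x + u n1) => e e0; have [n0 h0] := xP e e0.
  exists (n0 + n1)%N => n nn.
  have nE : n = (n - n1 + n1)%N by rewrite subnK// (leq_trans _ nn)// leq_addl.
  have -> : u n - (x + u n1) = v (n - n1)%N - x.
    by rewrite /v -nE opprD addrA addrAC.
  apply/dilE => //; split; last first.
    by apply: h0; rewrite leq_subRL ?(leq_trans _ nn) ?leq_addl// addnC.
  move=> W sW TW; rewrite addrC -scaleN1r; apply: (proj2 sW); [exact: hx|exact: vS].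
Qed.

Lemma disk_spec_complete T : disk_spec T -> complete_disk T.
Proof.
move=> [acT sepT clT coT]; split => //.
pose G x := [set r | 0 < r /\ dil r T x].
pose N x := inf (G x).
have lbG x : has_lbound (G x) by exists 0 => r [/ltW].
have neG x : lin_span T x -> G x !=set0 by move=> /(spanE acT)[r r0 h]; exists r.
have Nle x r : 0 < r -> dil r T x -> N x <= r.
  by move=> r0 h; apply: ge_inf => //; split.
have ltN x r : lin_span T x -> N x < r -> 0 < r /\ dil r T x.
  move=> hx /(inf_lt (neG _ hx))[s [s0 hs] sr]; split; first exact: lt_trans sr.
  by apply: (dil_le acT _ _ hs); exact: ltW.
have N0 x : lin_span T x -> 0 <= N x.
  by move=> hx; apply: lb_le_inf; [exact: neG|move=> r [/ltW]].
have dilN e x : lin_span T x -> 0 < e -> dil (N x + e) T x.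
  by move=> hx e0; apply: (ltN _ _ hx _).2; rewrite ltrDl.
have Npos e x : lin_span T x -> 0 < e -> 0 < N x + e.
  by move=> hx e0; rewrite ltr_wpDl ?N0.
have sZ c x : lin_span T x -> lin_span T (c *: x).
  by move=> hx W sW TW; rewrite -[_ *: _]addr0; apply: (proj2 sW);
    [exact: hx|exact: sW.1].
have NZle c x : lin_span T x -> N (c *: x) <= normc c * N x.
  move=> hx; apply/ler_addgt0Pr => e e0.
  have d0 : 0 < e / (normc c + 1) by rewrite divr_gt0// ltr_wpDl ?normc_ge0.
  apply: Nle; first by rewrite ltr_wpDl// mulr_ge0 ?normc_ge0 ?N0.
  apply: (dilZ acT _ _ (dilN _ _ hx d0)); first exact/ltW/Npos.
  rewrite mulrDr lerD2l mulrCA ger_pMr// ler_pdivrMr ?ltr_wpDl ?normc_ge0//.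
  by rewrite mul1r lerDl.
exists N; split.
- split => //.
  + move=> x hx Nx; apply: sepT => e e0.
    by have := dilN e x hx e0; rewrite Nx add0r.
  + move=> c x hx; apply/eqP; rewrite eq_le NZle//=.
    have [->|cn] := eqVneq c 0; first by rewrite normc0 mul0r N0//; exact: sZ.
    have := NZle c^-1 (c *: x) (sZ _ _ hx).
    rewrite scalerA mulVf// scale1r normcV ler_pdivlMl//.
    rewrite lt_def normc_ge0 andbT; apply: contra cn => /eqP/eq0_normc ->.
    by [].
  + move=> x y hx hy; apply/ler_addgt0Pr => e e0.
    have e2 : 0 < e / 2 by rewrite divr_gt0.
    rewrite (splitr e) addrACA; apply: Nle; first by rewrite addr_gt0 ?Npos.
    by apply: dilD => //; rewrite ?ltW ?Npos//; exact: dilN.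
- move=> u hu Cu.
  have uS m n : lin_span T (u m - u n).
    by move=> W sW TW; rewrite addrC -scaleN1r; apply: (proj2 sW);
      [exact: hu|exact: hu].
  have [x xP] : exists x, forall e, 0 < e -> exists n0, forall n, (n0 <= n)%N ->
       dil e T (u n - x).
    apply: coT => e e0; have e2 : 0 < e / 2 by rewrite divr_gt0.
    have [n0 h0] := Cu _ e2; exists n0 => m n mn nn.
    apply: (proj2 (ltN _ _ _ _)) => //.
    by apply: le_lt_trans (h0 _ _ mn nn) _; rewrite ltr_pdivrMr// ltr_pMr// ltr1n.
  exists x.
    have [n0 h0] := xP 1 ltr01.
    have hd : lin_span T (u n0 - x) by apply/(spanE acT); exists 1 => //; exact: h0.
    move=> W sW TW; have -> : x = (-1) *: (u n0 - x) + u n0.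
      by rewrite scaleN1r opprB subrK.
    by apply: (proj2 sW); [exact: hd|exact: hu].
  move=> e e0; have [n0 h0] := xP e e0; exists n0 => n nn.
  by apply: Nle => //; exact: h0.
- apply/seteqP; split => x /=.
    move=> Tx; have d1 : dil 1 T x by rewrite dil1.
    by split; [apply/(spanE acT); exists 1|exact: Nle].
  move=> [hx Nx]; apply: clT => e e0; apply: (proj2 (ltN _ _ hx _)).
  by rewrite (le_lt_trans Nx)// ltrDl.
Qed.

Lemma complete_diskP T : complete_disk T <-> disk_spec T.
Proof. split; [exact: complete_disk_spec|exact: disk_spec_complete]. Qed.

Lemma dil_limit T a x : disk_spec T -> 0 <= a ->
  (forall e, 0 < e -> dil (a + e) T x) -> dil a T x.
Proof.
move=> [acT sepT clT _]; rewrite le_eqVlt => /orP[/eqP<- h|a0 h].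
  suff -> : x = 0 by exact: dil0.
  by apply: sepT => e e0; rewrite -[e]add0r; exact: h.
apply/dil_inv => //; apply: clT => e e0.
have := h (a * e) (mulr_gt0 a0 e0); rewrite -[X in X + _]mulr1 -mulrDr => hx.
apply: (dilZ acT _ _ hx); first by rewrite mulr_ge0// ltW// addr_gt0.
by rewrite normcR gtr0_norm ?invr_gt0// mulrA mulVf ?gt_eqF// mul1r.
Qed.

Lemma disk_spec_dil T r : disk_spec T -> 0 < r -> disk_spec (dil r T).
Proof.
move=> dT r0; have [acT sepT clT coT] := dT; have rn : r != 0 by rewrite gt_eqF.
have toT (P : R -> Prop) : (forall e, 0 < e -> P e) ->
    forall e, 0 < e -> P (e / r).
  by move=> h e e0; apply: h; rewrite divr_gt0.
have E e : dil (e / r) (dil r T) = dil e T by rewrite dil_dil divfK.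
split.
- by apply: abs_convex_dil => //; exact: ltW.
- by move=> x /toT h; apply: sepT => e /h; rewrite E.
- move=> x h; apply: dil_limit; rewrite ?(ltW r0)// => e e0.
  have := h (e / r); rewrite divr_gt0// => /(_ isT).
  by rewrite dil_dil mulrDl mul1r divfK.
- move=> u /toT Cu; have [e e0|x hx] := coT u.
    by have := Cu e e0; rewrite E.
  exists x => e e0; have [n0 h0] := hx (e * r) (mulr_gt0 e0 r0).
  by exists n0 => n nn; rewrite dil_dil; exact: h0.
Qed.

Lemma disk_spec0 : disk_spec [set 0].
Proof.
have z e (x : V) : dil e [set 0] x -> x = 0 by move=> [_ -> <-]; rewrite scaler0.
split.
- by split => // a b _ _ _ -> ->; rewrite !scaler0 addr0.
- by move=> x /(_ 1 ltr01)/z.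
- by move=> x /(_ 1 ltr01)/z.
- move=> u /(_ 1 ltr01)[n0 h0]; exists (u n0) => e e0; exists n0 => n nn.
  by have /z -> := h0 _ _ nn (leqnn n0); exists 0 => //; rewrite scaler0.
Qed.
End Disks.

Record subspace (R : realType) (V : lmodType R[i]) := Subspace {
  subspace_set :> V -> Prop;
  subspaceP : is_subspace subspace_set }.

Section SubspaceType.
Variables (R : realType) (V : lmodType R[i]) (K : subspace V).

Definition subspace_pred : {pred V} := [pred x | `[< K x >]].

Lemma subspace_submod : submod_closed subspace_pred.
Proof.
have [K0 KD] := subspaceP K.
split=> [|c x y]; first exact/asboolP.
by move=> /asboolP hx /asboolP hy; apply/asboolP; exact: KD.
Qed.

HB.instance Definition _ :=
  GRing.isSubmodClosed.Build R[i] V subspace_pred subspace_submod.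

Definition subspace_type := {x : V | x \in subspace_pred}.
HB.instance Definition _ := SubChoice.on subspace_type.
HB.instance Definition _ := [SubChoice_isSubLmodule of subspace_type by <:].

Lemma subspace_valP (x : subspace_type) : K (val x).
Proof. by have /asboolP := valP x. Qed.

Lemma subspace_inP x : K x -> x \in subspace_pred.
Proof. by move=> h; apply/asboolP. Qed.

Definition subspace_in x (h : K x) : subspace_type := exist _ x (subspace_inP h).
End SubspaceType.

Section QuotientType.
Local Open Scope quotient_scope.
Variables (R : realType) (V : lmodType R[i]) (K : subspace V).
Implicit Types x y : V.

Definition quot_rel x y := `[< K (x - y) >].

Lemma quot_rel_equiv : equiv_class_of quot_rel.
Proof.
have [K0 KD] := subspaceP K; split.
- by move=> x; apply/asboolP; rewrite subrr.
- move=> x y; apply/idP/idP => /asboolP h; apply/asboolP.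
    by have := KD (-1) _ _ h K0; rewrite scaleN1r opprB addr0.
  by have := KD (-1) _ _ h K0; rewrite scaleN1r opprB addr0.
- move=> y x z /asboolP h1 /asboolP h2; apply/asboolP.
  by have := KD 1 _ _ h1 h2; rewrite scale1r addrA subrK.
Qed.

Canonical quot_rel_equiv_rel := EquivRelPack quot_rel_equiv.

Definition quot_type := {eq_quot quot_rel}.
HB.instance Definition _ := Choice.on quot_type.

Definition quot_pi x : quot_type := \pi_quot_type x.
Definition quot_repr (q : quot_type) : V := repr q.

Lemma quot_piK q : quot_pi (quot_repr q) = q.
Proof. exact: reprK. Qed.

Lemma quot_piP x y : quot_pi x = quot_pi y <-> K (x - y).
Proof.
split=> [/eqP|h]; first by rewrite /quot_pi eqmodE => /asboolP.
by apply/eqP; rewrite /quot_pi eqmodE; apply/asboolP.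
Qed.

Definition quot_add (p q : quot_type) := quot_pi (quot_repr p + quot_repr q).
Definition quot_opp (p : quot_type) := quot_pi (- quot_repr p).
Definition quot_scale (c : R[i]) (p : quot_type) := quot_pi (c *: quot_repr p).

Lemma quot_repr_pi x : K (quot_repr (quot_pi x) - x).
Proof. by apply/quot_piP; rewrite quot_piK. Qed.

Lemma quot_addE x y : quot_add (quot_pi x) (quot_pi y) = quot_pi (x + y).
Proof.
apply/quot_piP; rewrite opprD addrACA.
by have := (subspaceP K).2 1 _ _ (quot_repr_pi x) (quot_repr_pi y); rewrite scale1r.
Qed.

Lemma quot_scaleE c x : quot_scale c (quot_pi x) = quot_pi (c *: x).
Proof.
apply/quot_piP; rewrite -scalerBr.
by have := (subspaceP K).2 c _ _ (quot_repr_pi x) (subspaceP K).1; rewrite addr0.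
Qed.

Lemma quot_oppE x : quot_opp (quot_pi x) = quot_pi (- x).
Proof. by rewrite -[- x]scaleN1r -quot_scaleE /quot_scale scaleN1r. Qed.

Lemma quot_addA : associative quot_add.
Proof.
by move=> p q r; rewrite -(quot_piK p) -(quot_piK q) -(quot_piK r) !quot_addE addrA.
Qed.
Lemma quot_addC : commutative quot_add.
Proof. by move=> p q; rewrite /quot_add addrC. Qed.
Lemma quot_add0 : left_id (quot_pi 0) quot_add.
Proof. by move=> p; rewrite -(quot_piK p) quot_addE add0r. Qed.
Lemma quot_addN : left_inverse (quot_pi 0) quot_opp quot_add.
Proof. by move=> p; rewrite -(quot_piK p) quot_oppE quot_addE addNr. Qed.

HB.instance Definition _ := GRing.isZmodule.Build quot_type
  quot_addA quot_addC quot_add0 quot_addN.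

Lemma quot_scaleA a b v : quot_scale a (quot_scale b v) = quot_scale (a * b) v.
Proof. by rewrite -(quot_piK v) !quot_scaleE scalerA. Qed.
Lemma quot_scale1 : left_id 1 quot_scale.
Proof. by move=> p; rewrite -(quot_piK p) quot_scaleE scale1r. Qed.
Lemma quot_scaleDr : right_distributive quot_scale +%R.
Proof.
move=> c p q; rewrite -(quot_piK p) -(quot_piK q).
by rewrite -[_ + _]/(quot_add _ _) -[RHS]/(quot_add _ _) !(quot_addE, quot_scaleE) scalerDr.
Qed.
Lemma quot_scaleDl v : {morph quot_scale^~ v : a b / a + b}.
Proof.
move=> a b; rewrite -(quot_piK v).
by rewrite -[RHS]/(quot_add _ _) !(quot_addE, quot_scaleE) scalerDl.
Qed.

HB.instance Definition _ := GRing.Zmodule_isLmodule.Build R[i] quot_type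
  quot_scaleA quot_scale1 quot_scaleDr quot_scaleDl.

Lemma quot_pi_linear : linear quot_pi.
Proof.
by move=> c x y; rewrite -[RHS]/(quot_add (quot_scale _ _) _) quot_scaleE quot_addE.
Qed.

HB.instance Definition _ := GRing.isLinear.Build R[i] V quot_type _ quot_pi quot_pi_linear.

Lemma quot_pi0 x : quot_pi x = 0 <-> K x.
Proof. by rewrite -(linear0 quot_pi) quot_piP subr0. Qed.
End QuotientType.

Record cbvs (R : realType) := CBVS {
  cbvs_sort :> lmodType R[i];
  bounded : set (set cbvs_sort);
  bounded_set1 : forall x, bounded [set x];
  bounded_subset : forall S S', S `<=` S' -> bounded S' -> bounded S;
  bounded_setU : forall S S', bounded S -> bounded S' -> bounded (S `|` S');
  bounded_scale : forall (c : R[i]) S, bounded S -> bounded [set c *: x | x in S];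
  bounded_in_disk : forall S, bounded S ->
    exists T, [/\ bounded T, complete_disk T & S `<=` T] }.

(* Convergence in the Banach space spanned by some bounded complete disk: [T] may
   always be enlarged so that its span contains [x] and finitely many terms. *)
Definition born_cvg (R : realType) (V : cbvs R) (u : nat -> V) (x : V) :=
  exists T : set V, [/\ bounded T, complete_disk T
    & forall e : R, 0 < e -> exists n0, forall n, (n0 <= n)%N ->
        dil e T (u n - x)].

Definition born_closed (R : realType) (V : cbvs R) (F : set V) :=
  forall (u : nat -> V) x, (forall n, F (u n)) -> born_cvg u x -> F x.

(* The least closed superset; adding limits of sequences once need not give a
   closed set. *)
Definition born_closure (R : realType) (V : cbvs R) (X : set V) : set V :=
  [set x | forall F, born_closed F -> X `<=` F -> F x].

Definition bounded_linear (R : realType) (V W : cbvs R) (phi : V -> W) :=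
  linear phi /\ forall S, bounded S -> bounded (phi @` S).

Section Basics.
Variables (R : realType).
Implicit Types U V W : cbvs R.

Lemma bnd_disk V (S : set V) : bounded S ->
  exists T, [/\ bounded T, disk_spec T & S `<=` T].
Proof. by move=> /bounded_in_disk[T [h /complete_diskP hT]]; exists T. Qed.

Lemma bnd_disk2 V (S S' : set V) : bounded S -> bounded S' ->
  exists T, [/\ bounded T, disk_spec T, S `<=` T & S' `<=` T].
Proof.
move=> bS bS'; have [T [bT dT hT]] := bnd_disk (bounded_setU bS bS').
by exists T; split => // x hx; apply: hT; [left|right].
Qed.

Lemma bnd_dil V (S : set V) r : bounded S -> bounded (dil r S).
Proof. exact: bounded_scale. Qed.

Lemma small_eq V (T T' : set V) (x y : V) : bounded T -> bounded T' ->
  (forall e : R, 0 < e -> exists z, dil e T (z - x) /\ dil e T' (z - y)) -> x = y.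
Proof.
move=> bT bT' h; have [D [bD dD TD TD']] := bnd_disk2 bT bT'.
apply/eqP; rewrite -subr_eq0; apply/eqP; apply: (ds_sep dD) => e e0.
have e2 : 0 < e / 2 by rewrite divr_gt0.
have [z [zx zy]] := h _ e2.
have -> : x - y = (z - y) - (z - x) by rewrite opprB [RHS]addrC addrA subrK.
rewrite (splitr e); apply: (dilB (ds_ac dD)); rewrite ?(ltW e2)//.
  exact: dil_mono zy.
exact: dil_mono zx.
Qed.

Lemma born_cvg_uniq V (u : nat -> V) x y : born_cvg u x -> born_cvg u y -> x = y.
Proof.
move=> [T [bT _ hT]] [T' [bT' _ hT']]; apply: (small_eq bT bT') => e e0.
have [n0 h0] := hT e e0; have [n1 h1] := hT' e e0.
exists (u (maxn n0 n1)).
by split; [apply: h0; rewrite leq_maxl|apply: h1; rewrite leq_maxr].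
Qed.

Lemma born_cvg_cst V (x : V) : born_cvg (fun=> x) x.
Proof.
have [T [bT dT _]] := bnd_disk (bounded_set1 x).
exists T; split => //; first exact/complete_diskP.
move=> e e0; exists 0%N => n _; rewrite subrr; exact: (dil0 (ds_ac dT)).
Qed.

Lemma born_cvgD V (u v : nat -> V) x y c : born_cvg u x -> born_cvg v y ->
  born_cvg (fun n => c *: u n + v n) (c *: x + y).
Proof.
move=> [T [bT _ hT]] [T' [bT' _ hT']].
have [D [bD dD TD TD']] := bnd_disk2 bT bT'; have acD := ds_ac dD.
exists D; split => //; first exact/complete_diskP.
move=> e e0; have e2 : 0 < e / 2 by rewrite divr_gt0.
have c0 : 0 < normc c + 1 by rewrite ltr_wpDl ?normc_ge0.
have [n0 h0] := hT _ (divr_gt0 e2 c0); have [n1 h1] := hT' _ e2.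
exists (maxn n0 n1) => n; rewrite geq_max => /andP[nn0 nn1].
have -> : c *: u n + v n - (c *: x + y) = c *: (u n - x) + (v n - y).
  by rewrite scalerBr opprD addrACA.
rewrite (splitr e); apply: dilD => //; rewrite ?(ltW e2)//.
  apply: (dilZ acD _ _ (dil_mono TD (h0 _ nn0))).
    by rewrite ltW// divr_gt0.
  by rewrite mulrCA ger_pMr// ler_pdivrMr// mul1r lerDl.
exact: dil_mono (h1 _ nn1).
Qed.

Lemma born_cvg_map V W (phi : V -> W) u x : bounded_linear phi ->
  born_cvg u x -> born_cvg (phi \o u) (phi x).
Proof.
move=> [lphi bphi] [T [bT dT hT]].
have [D [bD dD TD]] := bnd_disk (bphi _ bT).
exists D; split => //; first exact/complete_diskP.
move=> e e0; have [n0 h0] := hT e e0; exists n0 => n nn /=.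
have [y Ty yE] := h0 _ nn.
have lB a b : phi (a - b) = phi a - phi b.
  by rewrite addrC -scaleN1r lphi scaleN1r addrC.
have lZ c a : phi (c *: a) = c *: phi a.
  have p0 : phi 0 = 0 by have := lB 0 0; rewrite !subrr.
  by have := lphi c a 0; rewrite p0 !addr0.
by rewrite -lB -yE lZ; exists (phi y) => //; apply: TD; exists y.
Qed.

Lemma closure_closed V (X : set V) : born_closed (born_closure X).
Proof.
move=> u x hu cu F cF XF; apply: (cF u) => // n; exact: hu.
Qed.

Lemma sub_closure V (X : set V) : X `<=` born_closure X.
Proof. by move=> x Xx F _; exact. Qed.

Lemma span_subspace V (X : set V) : is_subspace (lin_span X).
Proof.
split=> [W [] //|c x y hx hy W sW XW].
by apply: (proj2 sW); [exact: hx|exact: hy].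
Qed.

Lemma closure_subspace V (W : set V) : is_subspace W ->
  is_subspace (born_closure W).
Proof.
move=> [W0 WD]; split; first exact: sub_closure.
move=> c x y hx hy.
have h1 w : W w -> born_closure W (c *: x + w).
  move=> Ww; apply: (hx [set x | born_closure W (c *: x + w)]) => [u z hu cu|z Wz].
    apply: (@closure_closed _ _ (fun n => c *: u n + w)) => //.
    exact: (born_cvgD _ cu (born_cvg_cst _)).
  by apply: sub_closure; exact: WD.
apply: (hy [set y | born_closure W (c *: x + y)]) => // u z hu cu.
apply: (@closure_closed _ _ (fun n => c *: x + u n)) => //.
exact: (born_cvgD _ (born_cvg_cst _) cu).
Qed.

Definition closed_span V (X : set V) : subspace V :=
  Subspace (closure_subspace (span_subspace X)).

Lemma closed_span_closed V (X : set V) : born_closed (closed_span X).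
Proof. exact: closure_closed. Qed.

Lemma closed_span_min V (X : set V) (F : set V) : born_closed F -> is_subspace F ->
  X `<=` F -> forall x, closed_span X x -> F x.
Proof. by move=> cF sF XF x; apply => // y; apply. Qed.

Lemma sub_closed_span V (X : set V) x : X x -> closed_span X x.
Proof. by move=> Xx; apply: sub_closure => W sW; exact. Qed.

Lemma bl0 V W (phi : V -> W) : bounded_linear phi -> phi 0 = 0.
Proof. by case=> l _; have := l (-1) 0 0; rewrite scaler0 addr0 scaleN1r addNr. Qed.
Lemma blZ V W (phi : V -> W) c x : bounded_linear phi -> phi (c *: x) = c *: phi x.
Proof. by move=> b; have := b.1 c x 0; rewrite (bl0 b) !addr0. Qed.
Lemma blD V W (phi : V -> W) x y : bounded_linear phi -> phi (x + y) = phi x + phi y.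
Proof. by move=> b; have := b.1 1 x y; rewrite !scale1r. Qed.
Lemma blN V W (phi : V -> W) x : bounded_linear phi -> phi (- x) = - phi x.
Proof. by move=> b; rewrite -scaleN1r blZ// scaleN1r. Qed.
Lemma blB V W (phi : V -> W) x y : bounded_linear phi -> phi (x - y) = phi x - phi y.
Proof. by move=> b; rewrite blD// blN. Qed.
Lemma bl_sum V W (phi : V -> W) (I : Type) (s : seq I) F : bounded_linear phi ->
  phi (\sum_(i <- s) F i) = \sum_(i <- s) phi (F i).
Proof.
move=> b; elim: s => [|a s IH]; first by rewrite !big_nil bl0.
by rewrite !big_cons blD// IH.
Qed.
Lemma bl_comp U V W (phi : V -> W) (psi : U -> V) :
  bounded_linear phi -> bounded_linear psi -> bounded_linear (phi \o psi).
Proof.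
move=> hphi hpsi; split=> [c x y|S bS] /=.
  by rewrite blD// blD// blZ// blZ.
by rewrite -image_comp; apply: hphi.2; exact: hpsi.2.
Qed.
Lemma bl_id V : bounded_linear (@id V).
Proof. by split => // S; rewrite image_id. Qed.

Lemma ker_closed V W (phi : V -> W) : bounded_linear phi ->
  born_closed [set x | phi x = 0].
Proof.
move=> b u x hu cu; apply: (born_cvg_uniq (born_cvg_map b cu)).
rewrite (_ : phi \o u = fun=> 0); first exact: born_cvg_cst.
by apply/funext => n /=; exact: hu.
Qed.

Lemma ker_subspace V W (phi : V -> W) : bounded_linear phi ->
  is_subspace [set x | phi x = 0].
Proof.
move=> b; split => /=; first exact: bl0.
by move=> c x y hx hy; rewrite blD// blZ// hx hy scaler0 addr0.
Qed.
End Basics.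

Section Quotient.
Variables (R : realType) (V : cbvs R) (K : subspace V) (Kc : born_closed K).
Let Q : lmodType R[i] := quot_type K.
Let pi : V -> Q := @quot_pi R V K.

Definition quot_bounded : set (set Q) :=
  [set D | exists2 S, bounded S & D `<=` pi @` S].

Lemma dil_pi r (T : set V) : dil r (pi @` T) = pi @` (dil r T).
Proof.
apply/seteqP; split=> [_ [_ [x Tx <-] <-]|_ [_ [x Tx <-] <-]].
  by exists (r%:C *: x); [exists x|rewrite /pi linearZ].
by exists (pi x); [exists x|rewrite /pi linearZ].
Qed.

Lemma quot_disk (T : set V) : bounded T -> disk_spec T ->
  disk_spec [set y : Q | forall e : R, 0 < e -> dil (1 + e) (pi @` T) y].
Proof.
move=> bT dT; have [acT sepT clT coT] := dT.
set T' := [set y | _].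
have acP : abs_convex (pi @` T).
  split; first by exists 0; [exact: ac0 acT|rewrite /pi linear0].
  move=> a b _ _ ab [x Tx <-] [y Ty <-]; exists (a *: x + b *: y).
    exact: (proj2 acT).
  by rewrite /pi linearD !linearZ.
have acT' : abs_convex T'.
  split; first by move=> e e0; exact: dil0.
  move=> a b x y ab hx hy e e0.
  have e1 : 0 <= 1 + e by rewrite addr_ge0// ltW.
  exact: ((abs_convex_dil acP e1).2 _ _ _ _ ab (hx _ e0) (hy _ e0)).
have T'P r y : 0 < r -> dil r T' y -> forall e, 0 < e -> dil (r + e) (pi @` T) y.
  move=> r0 [z hz <-] e e0; apply: (dilZ acP _ _ (hz (e / r) (divr_gt0 e0 r0))).
    by rewrite addr_ge0// ltW// divr_gt0.
  by rewrite normcR gtr0_norm// mulrDr mulr1 mulrCA divff ?mulr1// gt_eqF.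
have PT' r y : 0 < r -> dil r (pi @` T) y -> dil r T' y.
  move=> r0; apply: dil_mono => z hz e e0.
  by apply: (@dil_le _ _ _ acP 1) => //; rewrite ?lerDl ?ltW ?dil1.
have T'lift r y : 0 < r -> dil r T' y -> exists2 t, dil (r + r) T t & pi t = y.
  by move=> r0 /T'P -/(_ r0 r r0); rewrite dil_pi => -[t ht <-]; exists t.
split => //.
- move=> y hy.
  have lift n : exists t, dil (2^-n) T t /\ pi t = y.
    have h : 0 < (2^-(n.+1) : R) by rewrite invr_gt0 exprn_gt0.
    have [t ht ty] := T'lift _ _ h (hy _ h).
    exists t; split => //; by move: ht; rewrite exprSr invfM -splitr.
  have [t ht] := choice lift.
  have /quot_piP : quot_pi K (t 0%N) = quot_pi K 0.
    apply/quot_piP; rewrite subr0; apply: (Kc (u := fun n => t 0%N - t n)).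
      by move=> n; apply/quot_piP; rewrite -/pi (ht 0%N).2 (ht n).2.
    exists T; split => //; first exact/complete_diskP.
    move=> e e0; exists (Num.truncn e^-1) => n nn.
    rewrite addrAC subrr sub0r; apply: (dilN acT); first exact: ltW.
    apply: (dil_le acT _ _ (ht n).1); first by rewrite invr_ge0 exprn_ge0.
    rewrite -[e]invrK lef_pV2 ?posrE ?invr_gt0 ?exprn_gt0//.
    apply: ltW; apply: (lt_le_trans (truncnS_gt _)).
    rewrite -natrX ler_nat; apply: leq_ltn_trans nn _; exact: ltn_expl.
  by rewrite subr0 => /quot_pi0; rewrite -/pi (ht 0%N).2.
- move=> y hy e e0; have e2 : 0 < e / 2 by rewrite divr_gt0.
  have := T'P _ _ _ (hy _ e2) _ e2; rewrite -addrA -splitr; apply.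
  by rewrite addr_gt0.
- move=> u Cu.
  have p0 n : 0 < (2^-n : R) by rewrite invr_gt0 exprn_gt0.
  have idx k : exists n0, forall m n, (n0 <= m)%N -> (n0 <= n)%N ->
      dil (2^-k) T' (u m - u n) by exact: Cu.
  have [f hf] := choice idx.
  pose g k := (\sum_(i < k.+1) f i)%N.
  have gf k : (f k <= g k)%N by rewrite /g big_ord_recr /= leq_addl.
  have gS k : (g k <= g k.+1)%N by rewrite /g [leqRHS]big_ord_recr /= leq_addr.
  have gm : {homo g : i j / (i <= j)%N} by apply: homo_leq => //; exact: leq_trans.
  have lift k : exists t, dil (2^-k + 2^-k) T t /\ pi t = u (g k.+1) - u (g k).
    have [||t ht tE] := @T'lift (2^-k) (u (g k.+1) - u (g k)) => //.
      by apply: hf => //; apply: leq_trans (gS k).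
    by exists t.
  have [t ht] := choice lift.
  pose x k := \sum_(i < k) t i.
  have pix k : pi (x k) = u (g k) - u (g 0%N).
    elim: k => [|k IH]; first by rewrite /x big_ord0 subrr /pi linear0.
    by rewrite /x big_ord_recr /= /pi linearD /= -/pi (ht k).2 -/(x k) IH
      addrC addrA subrK.
  have xd k j : dil (4 * 2^-k - 4 * 2^-(k + j)) T (x (k + j)%N - x k).
    elim: j => [|j IH]; first by rewrite addn0 !subrr; exact: dil0.
    rewrite addnS /x big_ord_recr /= -/(x _) addrAC.
    have -> : (4 * 2^-k - 4 * 2^-(k + j).+1 : R) =
        (4 * 2^-k - 4 * 2^-(k + j)) + (2^-(k + j) + 2^-(k + j)).
      rewrite exprS invfM; set a := 2^-k; set b := 2^-_; lra.
    apply: (dilD acT) => //; last exact: (ht _).1.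
    - rewrite subr_ge0 ler_pM2l// lef_pV2 ?posrE ?exprn_gt0//.
      by rewrite ler_weXn2l ?ler1n// leq_addr.
    - by rewrite addr_ge0// ltW.
  have xd4 k n : (k <= n)%N -> dil (4 * 2^-k) T (x n - x k).
    move=> kn; rewrite -(subnKC kn); apply: (dil_le acT _ _ (xd k (n - k)%N)).
      rewrite subr_ge0 ler_pM2l// lef_pV2 ?posrE ?exprn_gt0//.
      by rewrite ler_weXn2l ?ler1n// leq_addr.
    by rewrite gerBl mulr_ge0// ltW.
  have small e : 0 < e -> exists k, (8 * 2^-k : R) <= e.
    move=> e0; exists (Num.truncn (8 / e)).
    have h8 : 0 < 8 / e by rewrite divr_gt0.
    rewrite ler_pdivrMr ?exprn_gt0// -ler_pdivrMl// mulrC.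
    apply: ltW; apply: (lt_le_trans (truncnS_gt _)).
    by rewrite -natrX ler_nat; exact: ltn_expl.
  have [e e0|z zP] := coT x.
    have [k hk] := small e e0; exists k => m n km kn.
    have -> : x m - x n = (x m - x k) - (x n - x k) by rewrite opprB addrA subrK.
    apply: (dil_le acT _ _ (dilB acT _ _ (xd4 _ _ km) (xd4 _ _ kn))).
    + by rewrite addr_ge0// mulr_ge0// ltW.
    + by apply: le_trans hk; rewrite -mulrDl -natrD.
    + by rewrite mulr_ge0// ltW.
    + by rewrite mulr_ge0// ltW.
  exists (pi z + u (g 0%N)) => e e0.
  have e2 : 0 < e / 2 by rewrite divr_gt0.
  have [k hk] := small _ e2; have [n1 h1] := zP _ e2.
  exists (f k) => n nn; pose m := maxn k n1.
  have -> : u n - (pi z + u (g 0%N)) = (u n - u (g m)) + pi (x m - z).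
    rewrite /pi linearB /= -/pi pix opprD.
    by rewrite addrA addrA addrA subrK [_ - _ - pi z]addrAC.
  rewrite (splitr e); apply: (dilD acT'); rewrite ?(ltW e2)//.
    have := hf k n (g m) nn (leq_trans (gf k) (gm _ _ (leq_maxl _ _))).
    apply: (dil_le acT'); first by rewrite ltW.
    by apply: le_trans hk; rewrite ler_peMl ?ltW// ltr1n.
  apply: PT' => //; rewrite dil_pi; exists (x m - z) => //.
  by apply: h1; rewrite leq_maxr.
Qed.

Lemma quot_bounded_set1 q : quot_bounded [set q].
Proof.
exists [set quot_repr q]; first exact: bounded_set1.
by move=> _ ->; exists (quot_repr q) => //; rewrite /pi quot_piK.
Qed.

Lemma quot_bounded_subset S S' : S `<=` S' -> quot_bounded S' -> quot_bounded S.
Proof. by move=> SS' [D bD hD]; exists D => //; exact: subset_trans hD. Qed.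

Lemma quot_bounded_setU S S' :
  quot_bounded S -> quot_bounded S' -> quot_bounded (S `|` S').
Proof.
move=> [D bD hD] [D' bD' hD']; exists (D `|` D'); first exact: bounded_setU.
by rewrite image_setU; exact: setUSS.
Qed.

Lemma quot_bounded_scale (c : R[i]) S :
  quot_bounded S -> quot_bounded [set c *: x | x in S].
Proof.
move=> [D bD hD]; exists [set c *: x | x in D]; first exact: bounded_scale.
move=> _ [q /hD[x Dx <-] <-]; exists (c *: x); first by exists x.
by rewrite /pi linearZ.
Qed.

Lemma quot_bounded_in_disk S : quot_bounded S ->
  exists T, [/\ quot_bounded T, complete_disk T & S `<=` T].
Proof.
move=> [D bD hD]; have [T [bT dT DT]] := bnd_disk bD.
exists [set y : Q | forall e : R, 0 < e -> dil (1 + e) (pi @` T) y].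
split; last 2 first.
- by apply/complete_diskP; exact: quot_disk.
- move=> y /hD[x Dx <-] e e0.
  rewrite dil_pi; exists x => //; apply: (@dil_le _ _ _ (ds_ac dT) 1) => //.
    by rewrite lerDl ltW.
  by rewrite dil1; exact: DT.
- exists (dil (1 + 1) T); first exact: bnd_dil.
  by move=> y /(_ 1 ltr01); rewrite dil_pi.
Qed.

Definition quot_cbvs : cbvs R :=
  CBVS quot_bounded_set1 quot_bounded_subset quot_bounded_setU
    quot_bounded_scale quot_bounded_in_disk.
End Quotient.

Lemma real_cauchy (R : realType) (u : nat -> R) :
  (forall e, 0 < e -> exists n0, forall m n, (n0 <= m)%N -> (n0 <= n)%N ->
     `|u m - u n| <= e) ->
  exists l, forall e, 0 < e -> exists n0, forall n, (n0 <= n)%N -> `|u n - l| <= e.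
Proof.
move=> Cu; pose E := [set x | exists n0, forall n, (n0 <= n)%N -> x <= u n].
have [n1 h1] := Cu 1 ltr01.
have ubE e n0 : (forall m n, (n0 <= m)%N -> (n0 <= n)%N -> `|u m - u n| <= e) ->
    ubound E (u n0 + e).
  move=> h x [k hk]; have := h (maxn k n0) n0 (leq_maxr _ _) (leqnn _).
  have := hk _ (leq_maxl k n0); rewrite ler_norml => h2 /andP[_].
  by rewrite lerBlDl; exact: le_trans.
have inE e n0 : (forall m n, (n0 <= m)%N -> (n0 <= n)%N -> `|u m - u n| <= e) ->
    E (u n0 - e).
  move=> h; exists n0 => n nn; have := h n n0 nn (leqnn _).
  by rewrite ler_norml => /andP[+ _]; rewrite lerBrDl.
have hsE : has_sup E.
  by split; [exists (u n1 - 1); exact: inE|exists (u n1 + 1); exact: ubE].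
exists (sup E) => e e0; have e2 : 0 < e / 2 by rewrite divr_gt0.
have [n0 h0] := Cu _ e2; exists n0 => n nn.
have h0' m k : (n <= m)%N -> (n <= k)%N -> `|u m - u k| <= e / 2.
  by move=> ? ?; apply: h0; apply: leq_trans nn _.
have a1 : u n - e / 2 <= sup E by apply: ub_le_sup; [exact: hsE.2|exact: inE].
have a2 : sup E <= u n + e / 2 by apply: ge_sup; [exact: hsE.1|exact: ubE].
by rewrite ler_norml; apply/andP; split; lra.
Qed.

Lemma normc_Re (R : realType) (z : R[i]) : `|complex.Re z| <= normc z.
Proof.
case: z => a b; rewrite /normc /= -sqrtr_sqr ler_sqrt ?lerDl ?sqr_ge0//.
by rewrite addr_ge0 ?sqr_ge0.
Qed.
Lemma normc_Im (R : realType) (z : R[i]) : `|complex.Im z| <= normc z.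
Proof.
case: z => a b; rewrite /normc /= -sqrtr_sqr ler_sqrt ?lerDr ?sqr_ge0//.
by rewrite addr_ge0 ?sqr_ge0.
Qed.
Lemma normcD_le (R : realType) (x y : R[i]) : normc (x + y) <= normc x + normc y.
Proof. exact: le_normcD. Qed.
Lemma normcNE (R : realType) (x : R[i]) : normc (- x) = normc x.
Proof. exact: normcN. Qed.
Lemma normc_ReIm (R : realType) (z : R[i]) : normc z <= `|complex.Re z| + `|complex.Im z|.
Proof.
case: z => a b; rewrite /normc /=.
have h : 0 <= `|a| + `|b| by rewrite addr_ge0.
rewrite -[leRHS](ger0_norm h) -sqrtr_sqr ler_sqrt ?sqr_ge0//.
rewrite sqrrD -(real_normK (num_real a)) -(real_normK (num_real b)).
by rewrite lerD2r lerDl mulrn_wge0// mulr_ge0.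
Qed.

Lemma complex_cauchy (R : realType) (u : nat -> R[i]) :
  (forall e : R, 0 < e -> exists n0, forall m n, (n0 <= m)%N -> (n0 <= n)%N ->
     normc (u m - u n) <= e) ->
  exists l, forall e : R, 0 < e -> exists n0, forall n, (n0 <= n)%N ->
     normc (u n - l) <= e.
Proof.
move=> Cu.
have [e e0|a ha] := @real_cauchy R (fun n => complex.Re (u n)).
  have [n0 h0] := Cu e e0; exists n0 => m n hm hn.
  by rewrite -raddfB; apply: le_trans (normc_Re _) (h0 _ _ hm hn).
have [e e0|b hb] := @real_cauchy R (fun n => complex.Im (u n)).
  have [n0 h0] := Cu e e0; exists n0 => m n hm hn.
  by rewrite -raddfB; apply: le_trans (normc_Im _) (h0 _ _ hm hn).
exists (a +i* b) => e e0; have e2 : 0 < e / 2 by rewrite divr_gt0.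
have [n0 h0] := ha _ e2; have [n1 h1] := hb _ e2.
exists (maxn n0 n1) => n; rewrite geq_max => /andP[hn0 hn1].
apply: (le_trans (normc_ReIm _)); rewrite !raddfB /= (splitr e).
by apply: lerD; [exact: h0|exact: h1].
Qed.

(* The l^1-space on a bornological set [(X, B)]: summable functions with
   bounded support. *)
Section Ell1.
Variables (R : realType) (X : choiceType) (B : set (set X)).
Hypothesis B0 : B set0.
Hypothesis B1 : forall p, B [set p].
Hypothesis BU : forall S S', B S -> B S' -> B (S `|` S').
Implicit Types (l : X -> R[i]) (S : set X).

Definition supported l S := forall p, l p != 0 -> S p.
Definition sums_le l (c : R) :=
  forall s : seq X, uniq s -> \sum_(p <- s) normc (l p) <= c.
Definition summable_bs l : Prop := (exists2 S, B S & supported l S) /\ exists c, sums_le l c.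

Lemma sums_leD l l' c c' a : sums_le l c -> sums_le l' c' ->
  sums_le (a *: l + l') (normc a * c + c').
Proof.
move=> h h' s us; apply: le_trans (lerD _ (h' s us)); last first.
  by apply: ler_wpM2l (h s us); rewrite normc_ge0.
rewrite mulr_sumr -big_split; apply: ler_sum => p _.
by rewrite -normcM; exact: normcD_le.
Qed.

Lemma supportedD l l' S S' a : supported l S -> supported l' S' ->
  supported (a *: l + l') (S `|` S').
Proof.
move=> h h' p; rewrite -[_ p]/(a * l p + l' p).
have [->|/h hp] := eqVneq (l p) 0; last by left.
by rewrite mulr0 add0r => /h'; right.
Qed.

Lemma sums_le_ge0 l c : sums_le l c -> 0 <= c.
Proof. by move=> /(_ [::] isT); rewrite big_nil. Qed.

Lemma sums_le_mono l c c' : c <= c' -> sums_le l c -> sums_le l c'.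
Proof. by move=> cc h s us; apply: le_trans cc; exact: h. Qed.

Lemma summable_bs_subspace : @is_subspace R (X -> R[i]) summable_bs.
Proof.
split=> [|a l l' [[S BS hS] [c hc]] [[S' BS' hS'] [c' hc']]].
  split; first by exists set0 => // p; rewrite eqxx.
  by exists 0 => s _; rewrite big1// => p _; rewrite normc0.
split; first by exists (S `|` S'); [exact: BU|exact: supportedD].
by exists (normc a * c + c'); exact: sums_leD.
Qed.

Definition ell1 := subspace_type (Subspace summable_bs_subspace).
HB.instance Definition _ := GRing.Lmodule.on ell1.
Implicit Types (f g : ell1).

Definition ell1_fun f : X -> R[i] := val f.

Definition ell1_bounded : set (set ell1) :=
  [set D | exists S c, B S /\ forall f, D f ->
     supported (ell1_fun f) S /\ sums_le (ell1_fun f) c].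

Definition ell1_ball S (c : R) : set ell1 :=
  [set f | supported (ell1_fun f) S /\ sums_le (ell1_fun f) c].

Lemma ell1P f : summable_bs (ell1_fun f).
Proof. exact: subspace_valP f. Qed.

Lemma ell1_funD f g : ell1_fun (f + g) = ell1_fun f + ell1_fun g.
Proof. exact: raddfD. Qed.
Lemma ell1_funB f g : ell1_fun (f - g) = ell1_fun f - ell1_fun g.
Proof. exact: raddfB. Qed.
Lemma ell1_funZ c f : ell1_fun (c *: f) = c *: ell1_fun f.
Proof. exact: linearZ. Qed.
Lemma ell1_fun0 : ell1_fun 0 = 0.
Proof. exact: raddf0. Qed.
Lemma ell1_fun_inj : injective ell1_fun.
Proof. exact: val_inj. Qed.
Lemma ell1_fun_sum (I : Type) (s : seq I) (F : I -> ell1) p :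
  ell1_fun (\sum_(i <- s) F i) p = \sum_(i <- s) ell1_fun (F i) p.
Proof.
elim: s => [|a s IH]; first by rewrite !big_nil ell1_fun0.
by rewrite !big_cons ell1_funD -IH.
Qed.

Lemma supportedZ c l S : supported l S -> supported (c *: l) S.
Proof.
move=> h p; rewrite -[_ p]/(c * l p) => hp; apply: h.
by apply: contraNneq hp => ->; rewrite mulr0.
Qed.
Lemma sums_leZ a l c : sums_le l c -> sums_le (a *: l) (normc a * c).
Proof.
move=> h s us; apply: le_trans (ler_wpM2l (normc_ge0 a) (h s us)).
by rewrite mulr_sumr ler_sum// => p _; rewrite -normcM.
Qed.

Lemma dil_ball S r f : 0 < r -> dil r (ell1_ball S 1) f <-> ell1_ball S r f.
Proof.
move=> r0; split=> [[g [gS g1] <-]|[fS fr]].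
  split; rewrite ell1_funZ; first exact: supportedZ.
  by have := sums_leZ r%:C g1; rewrite normcR gtr0_norm// mulr1.
apply/dil_inv => //; split; rewrite ell1_funZ; first exact: supportedZ.
have := sums_leZ r^-1%:C fr.
by rewrite normcR gtr0_norm ?invr_gt0// mulVf// gt_eqF.
Qed.

Lemma sums_le1 l c p : sums_le l c -> normc (l p) <= c.
Proof. by move=> /(_ [:: p] isT); rewrite big_seq1. Qed.

Lemma ell1_ball_disk S : B S -> disk_spec (ell1_ball S 1).
Proof.
move=> BS; split.
- split.
    split=> [p|s _]; first by rewrite ell1_fun0 -[0 p]/0 eqxx.
    by rewrite big1// => p _; rewrite ell1_fun0 -[0 p]/0 normc0.
  move=> a b f g ab [fS f1] [gS g1]; split; rewrite ell1_funD !ell1_funZ.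
    by rewrite -[S]setUid; apply: supportedD => //; exact: supportedZ.
  apply: sums_le_mono ab _; rewrite -[normc a]mulr1 -[normc b]mulr1.
  by apply: sums_leD => //; exact: sums_leZ.
- move=> f h; apply: ell1_fun_inj; apply/funext => p.
  rewrite ell1_fun0; apply: eq0_normc; apply/eqP; rewrite eq_le normc_ge0 andbT.
  apply/ler_addgt0Pr => e e0; rewrite add0r; apply: sums_le1.
  by have /dil_ball -/(_ e0)[] := h e e0.
- move=> f h; have h' e : 0 < e -> ell1_ball S (1 + e) f.
    by move=> e0; apply/dil_ball; [rewrite addr_gt0|exact: h].
  split; first by case: (h' 1 ltr01).
  move=> s us; apply/ler_addgt0Pr => e e0; by have [_] := h' e e0; apply.
- move=> u Cu'.
  have Cu e : 0 < e -> exists n0, forall m n, (n0 <= m)%N -> (n0 <= n)%N ->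
      ell1_ball S e (u m - u n).
    by move=> e0; have [n0 h0] := Cu' e e0; exists n0 => m n hm hn;
      apply/dil_ball => //; exact: h0.
  have lim p : exists z, forall e : R, 0 < e -> exists n0, forall n, (n0 <= n)%N ->
      normc (ell1_fun (u n) p - z) <= e.
    apply: complex_cauchy => e e0; have [n0 h0] := Cu e e0.
    exists n0 => m n hm hn; have [_ /sums_le1] := h0 m n hm hn.
    by move=> /(_ p); rewrite ell1_funB.
  have [l hl] := choice lim.
  have lims s e : 0 < e -> exists n0, forall n, (n0 <= n)%N ->
      \sum_(p <- s) normc (ell1_fun (u n) p - l p) <= e.
    elim: s e => [|p s IH] e e0.
      by exists 0%N => n _; rewrite big_nil ltW.
    have e2 : 0 < e / 2 by rewrite divr_gt0.
    have [n0 h0] := hl p _ e2; have [n1 h1] := IH _ e2.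
    exists (maxn n0 n1) => n; rewrite geq_max => /andP[hn0 hn1].
    by rewrite big_cons (splitr e); apply: lerD; [exact: h0|exact: h1].
  have close e n0 : 0 < e -> (forall m n, (n0 <= m)%N -> (n0 <= n)%N ->
      ell1_ball S e (u m - u n)) -> forall n, (n0 <= n)%N ->
      supported (ell1_fun (u n) - l) S /\ sums_le (ell1_fun (u n) - l) e.
    move=> e0 h0 n hn; split.
      move=> p; rewrite -[_ p]/(ell1_fun (u n) p - l p) => hp.
      apply: contrapT => nS.
      have cst m : (n0 <= m)%N -> ell1_fun (u m) p = ell1_fun (u n) p.
        move=> hm; have [hS _] := h0 m n hm hn.
        apply/eqP; rewrite -subr_eq0; apply/negPn/negP => hne; apply: nS.
        by apply: hS; rewrite ell1_funB.
      move/eqP : hp; apply; apply: eq0_normc; apply/eqP.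
      rewrite eq_le normc_ge0 andbT; apply/ler_addgt0Pr => d d0; rewrite add0r.
      have [n1 h1] := hl p d d0.
      by rewrite -(cst (maxn n0 n1)) ?leq_maxl//; apply: h1; rewrite leq_maxr.
    move=> s us; apply/ler_addgt0Pr => d d0; have [n1 h1] := lims s d d0.
    pose m := maxn n0 n1.
    have := lerD ((h0 n m hn (leq_maxl _ _)).2 s us) (h1 m (leq_maxr _ _)).
    apply: le_trans; rewrite -big_split ler_sum// => p _.
    apply: le_trans (normcD_le _ _); rewrite ell1_funB.
    by rewrite -[(_ - l) p]/(ell1_fun (u n) p - l p) 
      -[(_ - ell1_fun (u m)) p]/(ell1_fun (u n) p - ell1_fun (u m) p) addrA subrK.
  have [n1 h1] := Cu 1 ltr01.
  have lP : summable_bs l.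
    have [lS l1] := close _ _ ltr01 h1 n1 (leqnn _).
    have -> : l = (-1 : R[i]) *: (ell1_fun (u n1) - l) + ell1_fun (u n1).
      by rewrite scaleN1r opprB subrK.
    apply: (proj2 summable_bs_subspace); last exact: ell1P.
    by split; [exists S|exists 1].
  exists (subspace_in (K := Subspace summable_bs_subspace) lP) => e e0.
  have [n0 h0] := Cu e e0; exists n0 => n hn; apply/dil_ball => //.
  have [a b] := close e n0 e0 h0 n hn.
  by split; rewrite ell1_funB.
Qed.

Lemma ell1_bounded_set1 f : ell1_bounded [set f].
Proof.
have [[S BS hS] [c hc]] := ell1P f.
by exists S, c; split => // _ ->.
Qed.

Lemma ell1_bounded_subset D D' : D `<=` D' -> ell1_bounded D' -> ell1_bounded D.
Proof. by move=> DD' [S [c [BS h]]]; exists S, c; split => // f /DD'; exact: h. Qed.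

Lemma ell1_bounded_setU D D' :
  ell1_bounded D -> ell1_bounded D' -> ell1_bounded (D `|` D').
Proof.
move=> [S [c [BS h]]] [S' [c' [BS' h']]].
exists (S `|` S'), (Num.max c c'); split; first exact: BU.
move=> f [/h|/h'] [fS fc]; split.
- by move=> p /fS; left.
- by apply: sums_le_mono fc; rewrite le_max lexx.
- by move=> p /fS; right.
- by apply: sums_le_mono fc; rewrite le_max lexx orbT.
Qed.

Lemma ell1_bounded_scale (a : R[i]) D :
  ell1_bounded D -> ell1_bounded [set a *: f | f in D].
Proof.
move=> [S [c [BS h]]]; exists S, (normc a * c); split => // _ [f /h[fS fc] <-].
by rewrite ell1_funZ; split; [exact: supportedZ|exact: sums_leZ].
Qed.

Lemma ell1_bounded_in_disk D : ell1_bounded D ->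
  exists T, [/\ ell1_bounded T, complete_disk T & D `<=` T].
Proof.
move=> [S [c [BS h]]]; pose c' := Num.max c 1.
have c0 : 0 < c' by rewrite lt_max ltr01 orbT.
exists (dil c' (ell1_ball S 1)); split.
- by exists S, c'; split => // f /dil_ball; exact.
- by apply/complete_diskP; apply: disk_spec_dil => //; exact: ell1_ball_disk.
- move=> f /h[fS fc]; apply/dil_ball => //; split => //.
  by apply: sums_le_mono fc; rewrite le_max lexx.
Qed.

Definition ell1_cbvs : cbvs R :=
  CBVS ell1_bounded_set1 ell1_bounded_subset ell1_bounded_setU
    ell1_bounded_scale ell1_bounded_in_disk.

Definition delta_fun (p q : X) : R[i] := (q == p)%:R.

Lemma delta_sums p : sums_le (delta_fun p) 1.
Proof.
move=> s us; rewrite (eq_bigr (fun q => (q == p)%:R)); last first.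
  by move=> q _; rewrite /delta_fun; case: eqP; rewrite (normc0, normc1).
have [ps|ps] := boolP (p \in s).
  rewrite (bigD1_seq p)//= eqxx big1 ?addr0// => q /negPf ->.
  by [].
rewrite big_seq big1 ?ler01// => q qs; case: eqP => // qp.
by rewrite qp (negPf ps) in qs.
Qed.

Lemma delta_supp p : supported (delta_fun p) [set p].
Proof. by move=> q; rewrite /delta_fun; have [->|] := eqVneq q p; rewrite ?eqxx. Qed.

Lemma delta_summable p : summable_bs (delta_fun p).
Proof.
split; first by exists [set p] => //; exact: delta_supp.
by exists 1; exact: delta_sums.
Qed.

Definition ell1_delta p : ell1_cbvs :=
  subspace_in (K := Subspace summable_bs_subspace) (delta_summable p).

Lemma ell1_tail l c e : sums_le l c -> 0 < e ->
  exists s, uniq s /\ forall t, uniq t -> (forall p, p \in t -> p \notin s) ->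
    \sum_(p <- t) normc (l p) <= e.
Proof.
move=> hl e0; pose E := [set \sum_(p <- s) normc (l p) | s in [set s : seq X | uniq s]].
have sE : has_sup E.
  split; first by exists (\sum_(p <- [::]) normc (l p)); exists [::].
  by exists c => _ [s us <-]; exact: hl.
have [_ [s us <-] hs] := sup_adherent e0 sE.
exists s; split => // t ut dis.
have u2 : uniq (s ++ t).
  by rewrite cat_uniq us ut andbT /=; apply/hasPn => p /dis.
have : \sum_(p <- s ++ t) normc (l p) <= sup E.
  by apply: ub_le_sup; [exact: sE.2|exists (s ++ t)].
rewrite big_cat /= => h; lra.
Qed.

Section Sum.
Variables (Y : cbvs R) (F : X -> Y).

Definition hasum l (y : Y) (T : set Y) := forall e : R, 0 < e ->
  exists s, uniq s /\ forall t, uniq t -> {subset s <= t} ->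
    dil e T (y - \sum_(p <- t) l p *: F p).

Lemma hasum_uniq l y y' T T' : bounded T -> bounded T' ->
  hasum l y T -> hasum l y' T' -> y = y'.
Proof.
move=> bT bT' h h'; apply: oppr_inj; apply: (small_eq bT bT') => e e0.
have [s [us hs]] := h e e0; have [s' [us' hs']] := h' e e0.
pose t := undup (s ++ s').
exists (- \sum_(p <- t) l p *: F p); rewrite !opprK ![- _ + _]addrC; split.
  by apply: hs; [exact: undup_uniq|move=> p ps; rewrite mem_undup mem_cat ps].
by apply: hs'; [exact: undup_uniq|move=> p ps; rewrite mem_undup mem_cat ps orbT].
Qed.

Lemma hasum_mono l y T T' : T `<=` T' -> hasum l y T -> hasum l y T'.
Proof.
move=> TT' h e e0; have [s [us hs]] := h e e0.
by exists s; split => // t ut st; apply: dil_mono TT' _ _; exact: hs.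
Qed.

Lemma hasumD l l' y y' a T : disk_spec T ->
  hasum l y T -> hasum l' y' T -> hasum (a *: l + l') (a *: y + y') T.
Proof.
move=> dT h h' e e0; have e2 : 0 < e / 2 by rewrite divr_gt0.
have a0 : 0 < normc a + 1 by rewrite ltr_wpDl ?normc_ge0.
have [s [us hs]] := h _ (divr_gt0 e2 a0); have [s' [us' hs']] := h' _ e2.
exists (undup (s ++ s')); split; first exact: undup_uniq.
move=> t ut st.
have -> : a *: y + y' - \sum_(p <- t) (a *: l + l') p *: F p =
   a *: (y - \sum_(p <- t) l p *: F p) + (y' - \sum_(p <- t) l' p *: F p).
  rewrite scalerBr addrACA -opprD scaler_sumr -big_split; congr (_ - _).
  apply: eq_bigr => p _ /=.
  by rewrite -[(a *: l + l') p]/(a * l p + l' p) scalerDl scalerA.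
rewrite (splitr e); apply: (dilD (ds_ac dT)); rewrite ?(ltW e2)//.
  apply: (dilZ (ds_ac dT) _ _ (hs t ut _)).
  - by rewrite ltW// divr_gt0.
  - by rewrite mulrCA ger_pMr// ler_pdivrMr// mul1r lerDl.
  - by move=> p ps; apply: st; rewrite mem_undup mem_cat ps.
by apply: hs' => // p ps; apply: st; rewrite mem_undup mem_cat ps orbT.
Qed.

Lemma sum_in_dil l S T (t : seq X) : disk_spec T -> supported l S ->
  (forall p, S p -> T (F p)) ->
  dil (\sum_(p <- t) normc (l p)) T (\sum_(p <- t) l p *: F p).
Proof.
move=> dT lS FT; apply: (dil_sum (ds_ac dT)) => p; first exact: normc_ge0.
have [->|lp] := eqVneq (l p) 0; first by rewrite scale0r; exact: (dil0 (ds_ac dT)).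
apply: (@dilZ _ _ _ (ds_ac dT) _ 1) => //; first by rewrite mulr1.
by rewrite dil1; apply: FT; exact: lS.
Qed.

Lemma sum_diff l S T e s t t' : disk_spec T -> supported l S ->
  (forall p, S p -> T (F p)) -> uniq s -> uniq t -> uniq t' ->
  (forall t, uniq t -> (forall p, p \in t -> p \notin s) ->
    \sum_(p <- t) normc (l p) <= e) ->
  {subset s <= t} -> {subset s <= t'} ->
  dil (e + e) T (\sum_(p <- t) l p *: F p - \sum_(p <- t') l p *: F p).
Proof.
move=> dT lS FT us ut ut' hs st st'.
have key r : uniq r -> {subset s <= r} ->
    dil e T (\sum_(p <- r) l p *: F p - \sum_(p <- s) l p *: F p).
  move=> ur sr.
  have pr : perm_eq r (s ++ [seq p <- r | p \notin s]).
    apply: uniq_perm => //.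
      rewrite cat_uniq us filter_uniq// andbT.
      by apply/hasPn => p; rewrite mem_filter => /andP[].
    move=> p; rewrite mem_cat mem_filter.
    by have [/sr ->|] := boolP (p \in s).
  rewrite (perm_big _ pr) big_cat /= [X in dil _ _ X]addrC addKr.
  apply: (dil_le (ds_ac dT) _ _ (sum_in_dil _ dT lS FT)).
    by apply: sumr_ge0 => p _; exact: normc_ge0.
  by apply: hs; [exact: filter_uniq|move=> p; rewrite mem_filter => /andP[]].
have e0 : 0 <= e by have := hs [::] isT; rewrite big_nil; apply.
rewrite -[X in dil _ _ X](subrKA (\sum_(p <- s) l p *: F p)).
by rewrite -[X in dil _ _ (_ + X)]opprB; apply: (dilB (ds_ac dT)) => //; exact: key.
Qed.

Lemma hasum_exists l S T c : disk_spec T -> supported l S -> sums_le l c ->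
  (forall p, S p -> T (F p)) -> exists y, hasum l y T /\ dil c T y.
Proof.
move=> dT lS lc FT; have acT := ds_ac dT.
have p0 (n : nat) : 0 < (n.+1%:R^-1 : R) by rewrite invr_gt0 ltr0Sn.
have tn n := ell1_tail lc (p0 n).
have [s hs] := choice tn.
pose r n := undup (flatten [seq s i | i <- iota 0 n.+1]).
have ur n : uniq (r n) by exact: undup_uniq.
have sr n m : (n <= m)%N -> {subset s n <= r m}.
  move=> nm p ps; rewrite mem_undup; apply/flattenP; exists (s n) => //.
  by apply/mapP; exists n => //; rewrite mem_iota /= ltnS.
have small e : 0 < e -> exists n : nat, (n.+1%:R^-1 + n.+1%:R^-1 : R) <= e.
  move=> e0; exists (Num.truncn (2 / e)); rewrite -[X in X + X]mul1r -mulrDl.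
  rewrite ler_pdivrMr ?ltr0Sn// -ler_pdivrMl// mulrC; apply: ltW; exact: truncnS_gt.
have [e e0|y hy] := ds_complete dT (u := fun n => \sum_(p <- r n) l p *: F p).
  have [n hn] := small e e0; exists n => m k hm hk.
  apply: (dil_le acT _ hn); first by rewrite addr_ge0// ltW.
  by apply: (sum_diff dT lS FT (hs n).1 (ur m) (ur k) (hs n).2); exact: sr.
have hy' : hasum l y T.
  move=> e e0; have e2 : 0 < e / 2 by rewrite divr_gt0.
  have [n hn] := small _ e2; exists (s n); split; first exact: (hs n).1.
  move=> t ut st; have [m hm] := hy _ e2; pose k := maxn n m.
  rewrite -(subrKA (\sum_(p <- r k) l p *: F p)) (splitr e).
  apply: (dilD acT); rewrite ?(ltW e2)//.
    by rewrite -opprB; apply: (dilN acT); [exact: ltW|apply: hm; rewrite leq_maxr].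
  apply: (dil_le acT _ hn); first by rewrite addr_ge0// ltW.
  by apply: (sum_diff dT lS FT (hs n).1 (ur k) ut (hs n).2) => //; apply: sr;
    rewrite leq_maxl.
exists y; split => //; apply: (dil_limit dT); first exact: sums_le_ge0 lc.
move=> e e0; have [t [ut /(_ t ut)]] := hy' e e0 => /(_ (fun _ h => h)) ht.
rewrite -[y](subrK (\sum_(p <- t) l p *: F p)) addrC.
apply: (dilD acT); rewrite ?(ltW e0)//; first exact: sums_le_ge0 lc.
apply: (dil_le acT _ (lc t ut)); last exact: (sum_in_dil _ dT lS FT).
by apply: sumr_ge0 => p _; exact: normc_ge0.
Qed.
End Sum.

Lemma ell1_restr f t p : uniq t ->
  ell1_fun (f - \sum_(q <- t) ell1_fun f q *: (ell1_delta q : ell1)) p =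
  if p \in t then 0 else ell1_fun f p.
Proof.
move=> ut; rewrite ell1_funB -[LHS]/(ell1_fun f p - _) ell1_fun_sum.
rewrite (eq_bigr (fun q => ell1_fun f q * (p == q)%:R)); last first.
  by move=> q _; rewrite ell1_funZ.
case: ifPn => pt.
  rewrite (bigD1_seq p)//= eqxx mulr1 big1 ?addr0 ?subrr// => q qp.
  by rewrite eq_sym (negPf qp) mulr0.
rewrite big_seq big1 ?subr0// => q qt; have [pq|] := eqVneq p q.
  by rewrite pq qt in pt.
by rewrite mulr0.
Qed.

Lemma ell1_hasum f S c : supported (ell1_fun f) S -> sums_le (ell1_fun f) c ->
  hasum ell1_delta (ell1_fun f) (f : ell1_cbvs) (ell1_ball S 1).
Proof.
move=> fS fc e e0; have [s [us hs]] := ell1_tail fc e0; exists s; split => // t ut st.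
apply/dil_ball => //; split.
  move=> p; rewrite ell1_restr//; case: ifP => _; first by rewrite eqxx.
  exact: fS.
move=> r rr; rewrite (bigID (mem t)) /= big1 ?add0r; last first.
  by move=> p pt; rewrite ell1_restr// pt normc0.
rewrite -big_filter; apply: le_trans (hs [seq p <- r | p \notin t] _ _).
- rewrite big_seq [leRHS]big_seq; apply: ler_sum => p; rewrite mem_filter => /andP[pt _].
  by rewrite ell1_restr// (negPf pt).
- exact: filter_uniq.
- by move=> p; rewrite mem_filter => /andP[pt _]; apply: contra pt; exact: st.
Qed.

Lemma hasum_map (Y : cbvs R) (psi : ell1_cbvs -> Y) f S c : bounded_linear psi ->
  B S -> supported (ell1_fun f) S -> sums_le (ell1_fun f) c ->
  exists2 T, bounded T & hasum (fun p => psi (ell1_delta p)) (ell1_fun f) (psi f) T.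
Proof.
move=> bp BS fS fc; exists (psi @` (ell1_ball S 1)).
  by apply: bp.2; exists S, 1; split.
move=> e e0; have [s [us hs]] := ell1_hasum fS fc e0; exists s; split => // t ut st.
have [g gb gE] := hs t ut st; exists (psi g); first by exists g.
rewrite -blZ// gE blB// bl_sum//; congr (_ - _); apply: eq_bigr => p _.
by rewrite blZ.
Qed.

Lemma ell1_bound (Y : cbvs R) (psi : ell1_cbvs -> Y) f S c (T : set Y) :
  bounded_linear psi -> B S -> supported (ell1_fun f) S -> sums_le (ell1_fun f) c ->
  bounded T -> disk_spec T -> (forall p, S p -> T (psi (ell1_delta p))) ->
  dil c T (psi f).
Proof.
move=> bp BS fS fc bT dT hT.
have [y [hy cy]] := hasum_exists dT fS fc hT.
have [T' bT' hT'] := hasum_map bp BS fS fc.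
by rewrite (hasum_uniq bT' bT hT' hy).
Qed.

Lemma ell1_ext (Y : cbvs R) (psi phi : ell1_cbvs -> Y) :
  bounded_linear psi -> bounded_linear phi ->
  (forall p, psi (ell1_delta p) = phi (ell1_delta p)) -> psi =1 phi.
Proof.
move=> bpsi bphi h f; have [[S BS fS] [c fc]] := ell1P f.
have [T bT hT] := hasum_map bpsi BS fS fc.
have [T' bT' hT'] := hasum_map bphi BS fS fc.
rewrite (_ : (fun p => phi (ell1_delta p)) = fun p => psi (ell1_delta p)) in hT'; last first.
  by apply/funext => p; rewrite h.
exact: hasum_uniq hT hT'.
Qed.

Lemma ell1_lift (Y : cbvs R) (F : X -> Y) :
  (forall S, B S -> bounded (F @` S)) ->
  exists psi : ell1_cbvs -> Y, bounded_linear psi /\ forall p, psi (ell1_delta p) = F p.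
Proof.
move=> hF.
have ex f : exists y, exists T, [/\ bounded T, disk_spec T & hasum F (ell1_fun f) y T].
  have [[S BS fS] [c fc]] := ell1P f.
  have [T [bT dT FT]] := bnd_disk (hF S BS).
  have [p Sp|y [hy _]] := hasum_exists (F := F) dT fS fc; first by apply: FT; exists p.
  by exists y, T.
have [psi hpsi] := choice ex.
have psiE f y T : bounded T -> hasum F (ell1_fun f) y T -> psi f = y.
  by move=> bT h; have [T' [bT' _ h']] := hpsi f; exact: hasum_uniq h' h.
exists psi; split; first split.
- move=> a f g; have [T [bT _ hT]] := hpsi f; have [T' [bT' _ hT']] := hpsi g.
  have [D [bD dD TD TD']] := bnd_disk2 bT bT'.
  apply: (psiE _ _ _ bD); rewrite ell1_funD ell1_funZ; apply: hasumD => //.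
    exact: hasum_mono hT.
  exact: hasum_mono hT'.
- move=> D [S [c [BS hD]]]; have [T [bT dT FT]] := bnd_disk (hF S BS).
  apply: (bounded_subset _ (bnd_dil c bT)) => _ [f /hD[fS fc] <-].
  have [p Sp|y [hy cy]] := hasum_exists (F := F) dT fS fc; first by apply: FT; exists p.
  by rewrite (psiE _ _ _ bT hy).
- move=> p; have [T [bT dT pT]] := bnd_disk (bounded_set1 (F p)).
  apply: (psiE _ _ _ bT) => e e0; exists [:: p]; split => // t ut pt.
  rewrite (bigD1_seq p) ?pt ?inE//= {1}/ell1_fun /= /delta_fun eqxx scale1r.
  rewrite big1 ?addr0 ?subrr; first exact: (dil0 (ds_ac dT)).
  by move=> q /negPf qp; rewrite /ell1_fun /= /delta_fun qp scale0r.
Qed.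
End Ell1.

Definition bounded_bilinear (R : realType) (U V W : cbvs R) (beta : U -> V -> W) :=
  [/\ forall v, linear (fun u => beta u v), forall u, linear (beta u)
    & forall S T, bounded S -> bounded T ->
        bounded [set beta u v | u in S & v in T]].

Definition born_iso (R : realType) (V W : cbvs R) (phi : V -> W) :=
  bounded_linear phi /\ exists psi : W -> V,
    [/\ bounded_linear psi, cancel phi psi & cancel psi phi].

Section Bilinear.
Variables (R : realType).
Implicit Types U V W : cbvs R.

Lemma bilinl U V W (b : U -> V -> W) v : bounded_bilinear b ->
  bounded_linear (fun u => b u v).
Proof.
move=> [l _ h]; split=> [|S bS]; first exact: l.
apply: (bounded_subset _ (h S [set v] bS (bounded_set1 v))).
by move=> _ [u Su <-]; exists u => //; exists v.
Qed.

Lemma bilinr U V W (b : U -> V -> W) u : bounded_bilinear b -> bounded_linear (b u).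
Proof.
move=> [_ l h]; split=> [|S bS]; first exact: l.
apply: (bounded_subset _ (h [set u] S (bounded_set1 u) bS)).
by move=> _ [v Sv <-]; exists u => //; exists v.
Qed.
End Bilinear.

Section Tensor.
Variables (R : realType) (V W : cbvs R).
Local Notation VW := (V * W)%type.

Definition prod_bounded : set (set VW) :=
  [set S | exists S1 S2, [/\ bounded S1, bounded S2 & S `<=` S1 `*` S2]].

Lemma prod_bounded_set1 p : prod_bounded [set p].
Proof.
exists [set p.1], [set p.2]; split; rewrite ?bounded_set1//; try exact: bounded_set1.
by move=> _ ->.
Qed.

Lemma prod_bounded_set0 : prod_bounded set0.
Proof.
by exists [set 0], [set 0]; split => //; exact: bounded_set1.
Qed.

Lemma prod_bounded_setU S S' :
  prod_bounded S -> prod_bounded S' -> prod_bounded (S `|` S').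
Proof.
move=> [S1 [S2 [b1 b2 h]]] [S1' [S2' [b1' b2' h']]].
exists (S1 `|` S1'), (S2 `|` S2'); split; try exact: bounded_setU.
by move=> p [/h[]|/h'[]] hp1 hp2; split; by [left|right].
Qed.

Definition tens_free : cbvs R :=
  ell1_cbvs R prod_bounded_set0 prod_bounded_setU.

Definition tens_gen (v : V) (w : W) : tens_free :=
  ell1_delta R prod_bounded_set0 prod_bounded_set1 prod_bounded_setU (v, w).

Definition tens_rel : set tens_free :=
  [set z | (exists c v v' w, z = tens_gen (c *: v + v') w
                                - (c *: tens_gen v w + tens_gen v' w))
        \/ (exists c v w w', z = tens_gen v (c *: w + w')
                                - (c *: tens_gen v w + tens_gen v w'))].

(* The complete tensor product: the free complete bornological vector space on the
   bornological set [V * W] modulo the closed span of the bilinearity relations.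
   Its universal property is [tens_lift] and [tens_ext]. *)
Definition ctens : cbvs R := quot_cbvs (closed_span_closed (X := tens_rel)).

Definition tens_pi (z : tens_free) : ctens := quot_pi (closed_span tens_rel) z.

Definition tpure (v : V) (w : W) : ctens := tens_pi (tens_gen v w).

Lemma tens_pi_bl : bounded_linear tens_pi.
Proof.
split; first exact: quot_pi_linear.
by move=> S bS; exists S.
Qed.

Lemma tens_pi_surj (t : ctens) : exists z, tens_pi z = t.
Proof. by exists (quot_repr t); rewrite /tens_pi quot_piK. Qed.

Lemma pure_bilinear : bounded_bilinear tpure.
Proof.
split.
- move=> w c v v'; rewrite /tpure -[in RHS]blZ; last exact: tens_pi_bl.
  rewrite -blD; last exact: tens_pi_bl.
  by apply/quot_piP; apply: sub_closed_span; left; exists c, v, v', w.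
- move=> v c w w'; rewrite /tpure -[in RHS]blZ; last exact: tens_pi_bl.
  rewrite -blD; last exact: tens_pi_bl.
  by apply/quot_piP; apply: sub_closed_span; right; exists c, v, w, w'.
- move=> S T bS bT; exists [set tens_gen v w | v in S & w in T].
    exists (S `*` T), 1; split; first by exists S, T; split.
    move=> _ [v Sv [w Tw <-]]; split; last exact: delta_sums.
    by move=> p /delta_supp ->.
  by move=> _ [v Sv [w Tw <-]]; exists (tens_gen v w) => //; exists v => //; exists w.
Qed.

Lemma tens_ext (Y : cbvs R) (phi psi : ctens -> Y) :
  bounded_linear phi -> bounded_linear psi ->
  (forall v w, phi (tpure v w) = psi (tpure v w)) -> phi =1 psi.
Proof.
move=> bphi bpsi h t; have [z <-] := tens_pi_surj t.
apply: (ell1_ext (B1 := @prod_bounded_set1) (psi := phi \o tens_pi) (phi := psi \o tens_pi)).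
- exact: (bl_comp bphi tens_pi_bl).
- exact: (bl_comp bpsi tens_pi_bl).
- by move=> [v w]; exact: h.
Qed.

Lemma tens_lift (Y : cbvs R) (beta : V -> W -> Y) : bounded_bilinear beta ->
  exists phi : ctens -> Y, bounded_linear phi /\
    forall v w, phi (tpure v w) = beta v w.
Proof.
move=> bb; have [bl br bS] := bb.
have [S [S1 [S2 [b1 b2 hS]]]|psi [bpsi hpsi]] :=
    @ell1_lift R _ _ prod_bounded_set0 prod_bounded_set1 prod_bounded_setU Y
      (fun p => beta p.1 p.2).
  apply: (bounded_subset _ (bS _ _ b1 b2)) => _ [p /hS[p1 p2] <-].
  by exists p.1 => //; exists p.2.
have kill : closed_span tens_rel `<=` [set z | psi z = 0].
  apply: closed_span_min; first exact: ker_closed.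
    exact: ker_subspace.
  have hg v w : psi (tens_gen v w) = beta v w by exact: hpsi.
  move=> _ [[c [v [v' [w ->]]]]|[c [v [w [w' ->]]]]] /=;
    rewrite (blB _ _ bpsi) (blD _ _ bpsi) (blZ _ _ bpsi) !hg; first by rewrite bl subrr.
  by rewrite br subrr.
have psi_repr z : psi (quot_repr (tens_pi z)) = psi z.
  by apply/eqP; rewrite -subr_eq0 -blB//; apply/eqP/kill; exact: quot_repr_pi.
exists (fun t => psi (quot_repr t)); split; last first.
  by move=> v w; rewrite psi_repr; exact: hpsi.
split=> [c t t'|D [S bdS hD]].
  have [z <-] := tens_pi_surj t; have [z' <-] := tens_pi_surj t'.
  by rewrite -(blZ _ _ tens_pi_bl) -(blD _ _ tens_pi_bl) !psi_repr (blD _ _ bpsi) (blZ _ _ bpsi).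
apply: (bounded_subset _ (bpsi.2 _ bdS)) => _ [t /hD[z Sz <-] <-].
by exists z => //; rewrite psi_repr.
Qed.

Lemma tens_bound (D : set ctens) : bounded D ->
  exists S T c, [/\ bounded S, bounded T &
    forall (Y : cbvs R) (phi : ctens -> Y) (T0 : set Y), bounded_linear phi ->
      bounded T0 -> disk_spec T0 ->
      (forall v w, S v -> T w -> T0 (phi (tpure v w))) ->
      forall t, D t -> dil c T0 (phi t)].
Proof.
move=> [E [S [c [[S1 [S2 [b1 b2 hS]]] hE]]] hD].
exists S1, S2, c; split => // Y phi T0 bphi bT0 dT0 h t /hD[z /hE[zS zc] <-].
apply: (ell1_bound (B1 := @prod_bounded_set1) (psi := phi \o tens_pi) (S := S1 `*` S2)) => //.
- exact: (bl_comp bphi tens_pi_bl).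
- by exists S1, S2; split.
- by move=> p /zS/hS.
- by move=> [v w] [/= hv hw]; exact: h.
Qed.
End Tensor.

Record balg (R : realType) := BAlg {
  balg_cbvs :> cbvs R;
  bmul : balg_cbvs -> balg_cbvs -> balg_cbvs;
  bmul_bilinear : bounded_bilinear bmul;
  bmulA : associative bmul }.

Section Opposite.
Variables (R : realType) (A : balg R).

Definition op_mul (a b : A) : A := bmul b a.

Lemma op_mul_bilinear : bounded_bilinear op_mul.
Proof.
have [l r h] := bmul_bilinear A; split => // S T bS bT.
apply: (bounded_subset _ (h T S bT bS)) => _ [a Sa [b Tb <-]].
by exists b => //; exists a.
Qed.

Lemma op_mulA : associative op_mul.
Proof. by move=> a b c; rewrite /op_mul bmulA. Qed.

Definition op_balg : balg R := BAlg op_mul_bilinear op_mulA.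
End Opposite.

Record bhom (R : realType) (A B : balg R) := BHom {
  bhom_fun :> A -> B;
  bhom_bl : bounded_linear bhom_fun;
  bhomM : forall a b, bhom_fun (bmul a b) = bmul (bhom_fun a) (bhom_fun b) }.

Definition op_bhom (R : realType) (A B : balg R) (f : bhom A B) :
    bhom (op_balg A) (op_balg B) :=
  @BHom R (op_balg A) (op_balg B) f (bhom_bl f) (fun a b => bhomM f b a).

Record bmod (R : realType) (A : balg R) := BMod {
  bmod_cbvs :> cbvs R;
  lact : A -> bmod_cbvs -> bmod_cbvs;
  lact_bilinear : bounded_bilinear lact;
  lactM : forall a b m, lact (bmul a b) m = lact a (lact b m) }.

(* Right modules are left modules over the opposite algebra. *)
Definition rbmod (R : realType) (A : balg R) := bmod (op_balg A).
Definition rbmod_cbvs (R : realType) (A : balg R) (M : rbmod A) : cbvs R :=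
  bmod_cbvs M.
Coercion rbmod_cbvs : rbmod >-> cbvs.
Definition ract (R : realType) (A : balg R) (M : rbmod A) (m : M) (a : A) : M :=
  @lact R (op_balg A) M a m.

Definition lreg (R : realType) (A : balg R) : bmod A :=
  @BMod R A A (@bmul R A) (bmul_bilinear A) (fun a b m => esym (bmulA a b m)).
Definition rreg (R : realType) (A : balg R) : rbmod A := lreg (op_balg A).

Section Restriction.
Variables (R : realType) (A B : balg R) (f : bhom A B) (M : bmod B).

Definition restr_act (a : A) (m : M) : M := lact (f a) m.

Lemma restr_bilinear : bounded_bilinear restr_act.
Proof.
have [l r h] := lact_bilinear M; split.
- by move=> m c a b; rewrite /restr_act (bhom_bl f).1 l.
- by move=> a; exact: r.
- move=> S T bS bT; apply: (bounded_subset _ (h _ _ ((bhom_bl f).2 _ bS) bT)).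
  by move=> _ [a Sa [m Tm <-]]; exists (f a); [exists a|exists m].
Qed.

Lemma restr_actM a b m : restr_act (bmul a b) m = restr_act a (restr_act b m).
Proof. by rewrite /restr_act bhomM lactM. Qed.

Definition restr : bmod A := BMod restr_bilinear restr_actM.
End Restriction.

Section HomType.
Variables (R : realType) (A : balg R) (M N : bmod A).

Definition is_mhom (g : M -> N) : Prop :=
  bounded_linear g /\ forall a m, g (lact a m) = lact a (g m).

Lemma is_mhom_subspace : @is_subspace R (M -> N) is_mhom.
Proof.
split=> [|c g h [bg gA] [bh hA]].
  split; last by move=> a m; rewrite (bl0 (bilinr a (lact_bilinear N))).
  split=> [c x y|S bS]; first by rewrite scaler0 addr0.
  by apply: (bounded_subset _ (bounded_set1 (0 : N))) => _ [x _ <-].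
split; last first.
  move=> a m; rewrite -[LHS]/(c *: g (lact a m) + h (lact a m)).
  have ba := bilinr a (lact_bilinear N).
  by rewrite -[(c *: g + h) m]/(c *: g m + h m) blD// blZ// gA hA.
split=> [d x y|S bS].
  rewrite -[LHS]/(c *: g (d *: x + y) + h (d *: x + y)).
  rewrite -[(c *: g + h) x]/(c *: g x + h x) -[(c *: g + h) y]/(c *: g y + h y).
  rewrite (blD _ _ bg) (blD _ _ bh) (blZ _ _ bg) (blZ _ _ bh).
  rewrite !scalerDr !scalerA [c * d]mulrC -!addrA; congr (_ + _).
  by rewrite addrCA.
have [T [bT dT gT hT]] := bnd_disk2 (bg.2 _ bS) (bh.2 _ bS).
have c0 := normc_ge0 c.
apply: (bounded_subset _ (bnd_dil (normc c * 1 + 1) bT)) => _ [x Sx <-].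
apply: (dilD (ds_ac dT)); rewrite ?mulr1//.
  apply: (@dilZ _ _ _ (ds_ac dT) _ 1) => //; rewrite ?mulr1 ?dil1//.
  by apply: gT; exists x.
by rewrite dil1; apply: hT; exists x.
Qed.

Definition mhom := subspace_type (Subspace is_mhom_subspace).
HB.instance Definition _ := GRing.Lmodule.on mhom.

Definition mhom_fun (g : mhom) : M -> N := val g.
Definition MHom (g : M -> N) (hg : is_mhom g) : mhom :=
  subspace_in (K := Subspace is_mhom_subspace) hg.
End HomType.
Coercion mhom_fun : mhom >-> Funclass.

Section HomSpace.
Variables (R : realType) (A : balg R) (M N : bmod A).
Local Notation H := (mhom M N).
Implicit Types (g h : H) (F : set H).

Definition equibounded : set (set H) :=
  [set F | forall S : set M, bounded S -> bounded [set (g : H) x | g in F & x in S]].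

Lemma mhomP g : is_mhom g.
Proof. exact: subspace_valP g. Qed.
Lemma mhom_bl g : bounded_linear g. Proof. exact: (mhomP g).1. Qed.
Lemma mhomA g a m : g (lact a m) = lact a (g m). Proof. exact: (mhomP g).2. Qed.
Lemma mhomE g h : g =1 h -> g = h.
Proof. by move=> e; apply: val_inj; exact/funext. Qed.
Lemma mhom_addE g h x : mhom_fun (g + h) x = g x + h x. Proof. by []. Qed.
Lemma mhom_oppE g x : mhom_fun (- g) x = - g x. Proof. by []. Qed.
Lemma mhom_scaleE c g x : mhom_fun (c *: g) x = c *: g x. Proof. by []. Qed.
Lemma mhom_zeroE x : mhom_fun (0 : H) x = 0. Proof. by []. Qed.
Lemma MHomE (phi : M -> N) (hphi : is_mhom phi) x : MHom hphi x = phi x. Proof. by []. Qed.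

Lemma equibounded_set1 g : equibounded [set g].
Proof.
move=> S bS; apply: (bounded_subset _ ((mhom_bl g).2 _ bS)).
by move=> _ [_ -> [x Sx <-]]; exists x.
Qed.

Lemma equibounded_subset F F' : F `<=` F' -> equibounded F' -> equibounded F.
Proof.
move=> FF' h S bS; apply: (bounded_subset _ (h S bS)).
by move=> _ [g /FF' Fg [x Sx <-]]; exists g => //; exists x.
Qed.

Lemma equibounded_setU F F' :
  equibounded F -> equibounded F' -> equibounded (F `|` F').
Proof.
move=> h h' S bS; apply: (bounded_subset _ (bounded_setU (h S bS) (h' S bS))).
move=> _ [g [Fg|Fg] [x Sx <-]]; [left|right];
  by exists g => //; exists x.
Qed.

Lemma equibounded_scale (c : R[i]) F :
  equibounded F -> equibounded [set c *: g | g in F].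
Proof.
move=> h S bS; apply: (bounded_subset _ (bounded_scale c (h S bS))).
by move=> _ [_ [g Fg <-] [x Sx <-]]; exists (g x) => //; exists g => //; exists x.
Qed.

Section HomDisk.
Variable T : set M -> set N.
Hypothesis bT : forall S, bounded S -> bounded (T S).
Hypothesis dT : forall S, bounded S -> disk_spec (T S).

Definition hom_disk : set H := [set g | forall S x, bounded S -> S x -> T S (g x)].

Lemma hom_disk_bounded : equibounded hom_disk.
Proof.
move=> S bS; apply: (bounded_subset _ (bT bS)).
by move=> _ [g Dg [x Sx <-]]; exact: Dg.
Qed.

Lemma dil_hom_disk r g : 0 < r ->
  dil r hom_disk g <-> forall S x, bounded S -> S x -> dil r (T S) (g x).
Proof.
move=> r0; split=> [[h Dh <-] S x bS Sx|h].
  by exists (mhom_fun h x) => //; exact: Dh.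
apply/dil_inv => // S x bS Sx; rewrite mhom_scaleE.
by apply/(dil_inv (T S) (g x) r0); exact: h.
Qed.

Lemma hom_disk_spec : disk_spec hom_disk.
Proof.
have ac S (bS : bounded S) := ds_ac (dT bS).
split.
- split; first by move=> S x bS Sx; rewrite mhom_zeroE; exact: ac0 (ac _ bS).
  move=> a b g h ab Dg Dh S x bS Sx; rewrite mhom_addE !mhom_scaleE.
  by apply: (ac _ bS).2 => //; [exact: Dg|exact: Dh].
- move=> g hg; apply: mhomE => x; rewrite mhom_zeroE.
  apply: (ds_sep (dT (bounded_set1 x))) => e e0.
  by have /dil_hom_disk -/(_ e0) := hg e e0; apply => //; exact: bounded_set1.
- move=> g hg S x bS Sx; apply: (ds_closed (dT bS)) => e e0.
  have e1 : 0 < 1 + e by rewrite addr_gt0.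
  by have /dil_hom_disk -/(_ e1) := hg e e0; apply.
- move=> u Cu'.
  have Cu e : 0 < e -> exists n0, forall m n, (n0 <= m)%N -> (n0 <= n)%N ->
      forall S x, bounded S -> S x -> dil e (T S) (mhom_fun (u m) x - mhom_fun (u n) x).
    move=> e0; have [n0 h0] := Cu' e e0; exists n0 => m n hm hn S x bS Sx.
    by have /dil_hom_disk -/(_ e0) := h0 _ _ hm hn; apply.
  have lim S x : bounded S -> S x -> exists y, forall e : R, 0 < e ->
      exists n0, forall n, (n0 <= n)%N -> dil e (T S) (mhom_fun (u n) x - y).
    move=> bS Sx; apply: (ds_complete (dT bS) (u := fun n => mhom_fun (u n) x)) => e e0.
    by have [n0 h0] := Cu e e0; exists n0 => m n hm hn; exact: h0.
  have lim1 x := lim [set x] x (bounded_set1 x) erefl.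
  have [l hl] := choice lim1.
  have cl x : born_cvg (fun n => mhom_fun (u n) x) (l x).
    exists (T [set x]); split; [exact/bT/bounded_set1| |exact: hl].
    exact/complete_diskP/dT/bounded_set1.
  have close e n0 : 0 < e -> (forall m n, (n0 <= m)%N -> (n0 <= n)%N ->
      forall S x, bounded S -> S x -> dil e (T S) (mhom_fun (u m) x - mhom_fun (u n) x)) ->
      forall n, (n0 <= n)%N -> forall S x, bounded S -> S x ->
      dil e (T S) (mhom_fun (u n) x - l x).
    move=> e0 h0 n hn S x bS Sx; have [y hy] := lim S x bS Sx.
    have <- : y = l x.
      apply: born_cvg_uniq (cl x); exists (T S).
      by split; [exact: bT|exact/complete_diskP/dT|exact: hy].
    apply: (dil_limit (dT bS)); first exact: ltW.
    move=> d d0; have [n1 h1] := hy d d0; pose m := maxn n0 n1.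
    rewrite -(subrKA (mhom_fun (u m) x)); apply: (dilD (ac _ bS)); rewrite ?(ltW e0) ?(ltW d0)//.
      by apply: h0 => //; rewrite leq_maxl.
    by apply: h1; rewrite leq_maxr.
  have ll : linear l.
    move=> c x y; apply: (born_cvg_uniq (cl _)).
    rewrite (_ : (fun n => _) = fun n => c *: mhom_fun (u n) x + mhom_fun (u n) y).
      exact: born_cvgD.
    by apply/funext => n; rewrite (mhom_bl (u n)).1.
  have lA a m : l (lact a m) = lact a (l m).
    apply: (born_cvg_uniq (cl _)).
    rewrite (_ : (fun n => _) = lact a \o (fun n => mhom_fun (u n) m)).
      exact: (born_cvg_map (bilinr a (lact_bilinear N))).
    by apply/funext => n /=; rewrite mhomA.
  have lb S : bounded S -> bounded (l @` S).
    move=> bS; have [n1 h1] := Cu 1 ltr01.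
    have [D [bD dD uD TD]] := bnd_disk2 ((mhom_bl (u n1)).2 _ bS) (bT bS).
    apply: (bounded_subset _ (bnd_dil (1 + 1) bD)) => _ [x Sx <-].
    rewrite -[l x](subKr (mhom_fun (u n1) x)); apply: (dilB (ds_ac dD)) => //.
      by rewrite dil1; apply: uD; exists x.
    apply: dil_mono TD _ _; exact: (close 1 n1 ltr01 h1 n1 (leqnn _)).
  have hom : is_mhom l by split.
  exists (MHom hom) => e e0; have [n0 h0] := Cu e e0.
  exists n0 => n hn; apply/dil_hom_disk => // S x bS Sx.
  by rewrite mhom_addE mhom_oppE MHomE; exact: close h0 n hn S x bS Sx.
Qed.
End HomDisk.

Lemma equibounded_in_disk F : equibounded F ->
  exists T, [/\ equibounded T, complete_disk T & F `<=` T].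
Proof.
move=> eF.
have ex (S : set M) : exists T : set N, bounded S ->
    [/\ bounded T, disk_spec T & [set (g : H) x | g in F & x in S] `<=` T].
  have [bS|nS] := pselect (bounded S); last by exists set0.
  by have [T hT] := bnd_disk (eF S bS); exists T.
have [T hT] := choice ex.
have bT S : bounded S -> bounded (T S) by move=> /hT[].
have dT S : bounded S -> disk_spec (T S) by move=> /hT[].
exists (hom_disk T); split; first exact: hom_disk_bounded.
  by apply/complete_diskP; exact: hom_disk_spec.
move=> g Fg S x bS Sx; have [_ _] := hT S bS; apply.
by exists g => //; exists x.
Qed.

Definition Hom_cbvs : cbvs R :=
  CBVS equibounded_set1 equibounded_subset equibounded_setU equibounded_scale
    equibounded_in_disk.
End HomSpace.

Section BalancedTensor.
Variables (R : realType) (A : balg R) (M : rbmod A) (N : bmod A).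

Definition btens_rel : set (ctens M N) :=
  [set z | exists m a n, z = tpure (ract m a) n - tpure m (lact a n)].

Definition btens : cbvs R := quot_cbvs (closed_span_closed (X := btens_rel)).

Definition btens_pi (t : ctens M N) : btens := quot_pi (closed_span btens_rel) t.

Definition bpure (m : M) (n : N) : btens := btens_pi (tpure m n).

Lemma btens_pi_bl : bounded_linear btens_pi.
Proof.
split; first exact: quot_pi_linear.
by move=> S bS; exists S.
Qed.

Lemma btens_pi_surj (t : btens) : exists z, btens_pi z = t.
Proof. by exists (quot_repr t); rewrite /btens_pi quot_piK. Qed.

Lemma bpure_bilinear : bounded_bilinear bpure.
Proof.
have [l r h] := pure_bilinear M N; split.
- move=> n c m m'; rewrite /bpure l.
  by rewrite (blD _ _ btens_pi_bl) (blZ _ _ btens_pi_bl).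
- move=> m c n n'; rewrite /bpure r.
  by rewrite (blD _ _ btens_pi_bl) (blZ _ _ btens_pi_bl).
- move=> S T bS bT; exists [set tpure m n | m in S & n in T]; first exact: h.
  move=> _ [m Sm [n Tn <-]]; exists (tpure m n) => //.
  by exists m => //; exists n.
Qed.

Lemma bpure_balanced m a n : bpure (ract m a) n = bpure m (lact a n).
Proof. by apply/quot_piP; apply: sub_closed_span; exists m, a, n. Qed.

Lemma btens_ext (Y : cbvs R) (phi psi : btens -> Y) :
  bounded_linear phi -> bounded_linear psi ->
  (forall m n, phi (bpure m n) = psi (bpure m n)) -> phi =1 psi.
Proof.
move=> bphi bpsi h t; have [z <-] := btens_pi_surj t.
apply: (tens_ext (phi := phi \o btens_pi) (psi := psi \o btens_pi)).
- exact: (bl_comp bphi btens_pi_bl).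
- exact: (bl_comp bpsi btens_pi_bl).
- by move=> m n; exact: h.
Qed.

Definition balanced (Y : cbvs R) (beta : M -> N -> Y) :=
  bounded_bilinear beta /\ forall m a n, beta (ract m a) n = beta m (lact a n).

Lemma btens_lift_ex (Y : cbvs R) (beta : M -> N -> Y) : balanced beta ->
  exists phi : btens -> Y, bounded_linear phi /\
    forall m n, phi (bpure m n) = beta m n.
Proof.
move=> [bb bal]; have [psi [bpsi hpsi]] := tens_lift bb.
have kill : closed_span btens_rel `<=` [set z | psi z = 0].
  apply: closed_span_min; first exact: ker_closed.
    exact: ker_subspace.
  move=> _ [m [a [n ->]]] /=.
  by rewrite (blB _ _ bpsi) !hpsi bal subrr.
have psi_repr z : psi (quot_repr (btens_pi z)) = psi z.
  by apply/eqP; rewrite -subr_eq0 -(blB _ _ bpsi); apply/eqP/kill; exact: quot_repr_pi.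
exists (fun t => psi (quot_repr t)); split; last first.
  by move=> m n; rewrite psi_repr; exact: hpsi.
split=> [c t t'|D [S bdS hD]].
  have [z <-] := btens_pi_surj t; have [z' <-] := btens_pi_surj t'.
  by rewrite -(blZ _ _ btens_pi_bl) -(blD _ _ btens_pi_bl) !psi_repr
    (blD _ _ bpsi) (blZ _ _ bpsi).
apply: (bounded_subset _ (bpsi.2 _ bdS)) => _ [t /hD[z Sz <-] <-].
by exists z => //; rewrite psi_repr.
Qed.

Lemma btens_bound (D : set btens) : bounded D ->
  exists S T c, [/\ bounded S, bounded T &
    forall (Y : cbvs R) (phi : btens -> Y) (T0 : set Y), bounded_linear phi ->
      bounded T0 -> disk_spec T0 ->
      (forall m n, S m -> T n -> T0 (phi (bpure m n))) ->
      forall t, D t -> dil c T0 (phi t)].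
Proof.
move=> [E bE hD]; have [S [T [c [bS bT h]]]] := tens_bound bE.
exists S, T, c; split => // Y phi T0 bphi bT0 dT0 hphi t /hD[z Ez <-].
by apply: (h Y (phi \o btens_pi)) => //; exact: (bl_comp bphi btens_pi_bl).
Qed.

Definition btens_lift (Y : cbvs R) (beta : M -> N -> Y) (h : balanced beta) :
    btens -> Y :=
  sval (cid (btens_lift_ex h)).

Lemma btens_lift_bl (Y : cbvs R) (beta : M -> N -> Y) (h : balanced beta) :
  bounded_linear (btens_lift h).
Proof. by rewrite /btens_lift; case: cid => phi []. Qed.

Lemma btens_liftE (Y : cbvs R) (beta : M -> N -> Y) (h : balanced beta) m n :
  btens_lift h (bpure m n) = beta m n.
Proof. by rewrite /btens_lift; case: cid => phi []. Qed.
End BalancedTensor.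

Section Ess.
Variables (R : realType) (A : balg R) (M : bmod A).
Local Notation E := (btens (rreg A) M).

Lemma ess_balanced (a : A) :
  balanced (fun (x : rreg A) (m : M) => bpure (bmul a x : rreg A) m).
Proof.
have [l r h] := bpure_bilinear (rreg A) M.
have [lm rm hm] := bmul_bilinear A.
split; last by move=> x b m; rewrite -bpure_balanced /ract /= /op_mul bmulA.
split.
- by move=> m c x y; rewrite rm l.
- by move=> x; exact: r.
- move=> S T bS bT.
  apply: (bounded_subset _ (h _ _ (hm [set a] S (bounded_set1 a) bS) bT)).
  move=> _ [x Sx [m Tm <-]]; exists (bmul a x); last by exists m.
  by exists a => //; exists x.
Qed.

Definition ess_act (a : A) : E -> E := btens_lift (ess_balanced a).

Lemma ess_act_pure a (x : rreg A) (m : M) :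
  ess_act a (bpure x m) = bpure (bmul a x : rreg A) m.
Proof. exact: btens_liftE. Qed.

Lemma ess_act_bl a : bounded_linear (ess_act a).
Proof. exact: btens_lift_bl. Qed.

Lemma bl_lincomb (V W : cbvs R) (phi psi : V -> W) (c : R[i]) :
  bounded_linear phi -> bounded_linear psi ->
  bounded_linear (fun x => c *: phi x + psi x).
Proof.
move=> bphi bpsi; split=> [d x y|S bS].
  rewrite (blD _ _ bphi) (blD _ _ bpsi) (blZ _ _ bphi) (blZ _ _ bpsi).
  by rewrite !scalerDr !scalerA [c * d]mulrC -!addrA; congr (_ + _); rewrite addrCA.
have [T [bT dT gT hT]] := bnd_disk2 (bphi.2 _ bS) (bpsi.2 _ bS).
apply: (bounded_subset _ (bnd_dil (normc c * 1 + 1) bT)) => _ [x Sx <-].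
apply: (dilD (ds_ac dT)); rewrite ?mulr1 ?normc_ge0//.
  apply: (@dilZ _ _ _ (ds_ac dT) _ 1) => //; rewrite ?mulr1 ?dil1//.
  by apply: gT; exists x.
by rewrite dil1; apply: hT; exists x.
Qed.

Lemma ess_act_bilinear : bounded_bilinear ess_act.
Proof.
have [l r h] := bpure_bilinear (rreg A) M.
have [lm rm hm] := bmul_bilinear A.
split.
- move=> t c a b; apply: (btens_ext (ess_act_bl _)
    (bl_lincomb c (ess_act_bl a) (ess_act_bl b))) => x m.
  by rewrite !ess_act_pure lm l.
- by move=> a; exact: (ess_act_bl a).1.
- move=> S D bS bD; have [S1 [T1 [c [bS1 bT1 hb]]]] := btens_bound bD.
  have [T0 [bT0 dT0 hT0]] := bnd_disk (h _ _ (hm S S1 bS bS1) bT1).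
  apply: (bounded_subset _ (bnd_dil c bT0)) => _ [a Sa [t Dt <-]].
  apply: (hb _ _ _ (ess_act_bl a) bT0 dT0) => // x m S1x T1m.
  rewrite ess_act_pure; apply: hT0; exists (bmul a x); last by exists m.
  by exists a => //; exists x.
Qed.

Lemma ess_actM a b t : ess_act (bmul a b) t = ess_act a (ess_act b t).
Proof.
apply: (btens_ext (ess_act_bl _) (bl_comp (ess_act_bl a) (ess_act_bl b))) => x m.
by rewrite /= !ess_act_pure bmulA.
Qed.

Definition Ess : bmod A := BMod ess_act_bilinear ess_actM.

Definition ess_pure (a : A) (m : M) : Ess := @bpure R A (rreg A) M a m.
End Ess.

Section EssLift.
Variables (R : realType) (A : balg R) (M N : bmod A).

Definition ess_balanced_mhom (beta : A -> M -> N) :=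
  [/\ bounded_bilinear beta,
      forall x a m, beta (bmul x a) m = beta x (lact a m)
    & forall a x m, beta (bmul a x) m = lact a (beta x m)].

Lemma ess_balanced_mhom_balanced (beta : A -> M -> N) : ess_balanced_mhom beta ->
  balanced (M := rreg A) (N := M) beta.
Proof. by case. Qed.

Lemma ess_lift_mhom (beta : A -> M -> N) (h : ess_balanced_mhom beta) :
  @is_mhom R A (Ess M) N (btens_lift (ess_balanced_mhom_balanced h)).
Proof.
split; first exact: btens_lift_bl.
move=> a t; set phi := btens_lift _.
have bphi : bounded_linear phi by exact: btens_lift_bl.
apply: (btens_ext (bl_comp bphi (ess_act_bl M a))
  (bl_comp (bilinr a (lact_bilinear N)) bphi)) => x m /=.
rewrite ess_act_pure /phi !btens_liftE; have [_ _ hA] := h; exact: hA.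
Qed.

Definition ess_lift (beta : A -> M -> N) (h : ess_balanced_mhom beta) :
    mhom (Ess M) N :=
  MHom (ess_lift_mhom h).

Lemma ess_liftE (beta : A -> M -> N) (h : ess_balanced_mhom beta) a m :
  ess_lift h (ess_pure a m) = beta a m.
Proof. exact: btens_liftE. Qed.
End EssLift.

Lemma ess_ext (R : realType) (A : balg R) (M N : bmod A) (g h : mhom (Ess M) N) :
  (forall a m, g (ess_pure a m) = h (ess_pure a m)) -> g = h.
Proof.
move=> e; apply: mhomE.
exact: (btens_ext (M := rreg A) (mhom_bl g) (mhom_bl h)).
Qed.

Section EssCounit.
Variables (R : realType) (A : balg R) (M : bmod A).

Lemma ess_counit_balanced : ess_balanced_mhom (@lact R A M).
Proof.
split; first exact: lact_bilinear.
- exact: lactM.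
- exact: lactM.
Qed.

Definition ess_counit : mhom (Ess M) M := ess_lift ess_counit_balanced.
End EssCounit.

Section REssCounit.
Variables (R : realType) (A : balg R) (M : rbmod A).

Lemma ress_counit_balanced : balanced (M := M) (N := lreg A) (@ract R A M).
Proof.
have [l r h] := lact_bilinear M; split.
  split=> [a|m|S T bS bT]; [exact: r|exact: l|].
  apply: (bounded_subset _ (h T S bT bS)) => _ [m Sm [a Ta <-]].
  by exists a => //; exists m.
move=> m a b; have := @lactM _ _ M b a m.
by rewrite /ract /= => <-.
Qed.

Definition ress_counit : btens M (lreg A) -> M := btens_lift ress_counit_balanced.
End REssCounit.

Definition essential (R : realType) (A : balg R) (M : bmod A) :=
  born_iso (ess_counit M).

Definition ressential (R : realType) (A : balg R) (M : rbmod A) :=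
  born_iso (@ress_counit R A M).

Definition proper_morphism (R : realType) (A B : balg R) (f : bhom A B) :=
  essential (restr f (lreg B)) /\ ressential (restr (op_bhom f) (rreg B)).

(* Extensions are given by their quotient map [p]; the kernel carries the
   subspace bornology, and a bounded linear section forces the quotient
   bornology. *)
Definition rel_projective (R : realType) (A : balg R) (P : bmod A) :=
  forall (E Q : bmod A) (p : mhom E Q),
    (exists s : Q -> E, bounded_linear s /\ forall q, p (s q) = q) ->
  forall g : mhom P Q, exists h : mhom P E, forall x, p (h x) = g x.

Definition has_approx_units (R : realType) (A : balg R) :=
  forall S : set A, bounded S -> exists (u : nat -> A) (T : set A),
    [/\ bounded T, complete_disk T &
      forall e : R, 0 < e -> exists n0, forall n, (n0 <= n)%N -> forall x, S x ->
        dil e T (bmul (u n) x - x) /\ dil e T (bmul x (u n) - x)].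

Definition quasi_unital (R : realType) (A : balg R) :=
  [/\ has_approx_units A, rel_projective (lreg A) & rel_projective (rreg A)].

Section Rgh.
Variables (R : realType) (A : balg R) (M : bmod A).
Local Notation H := (Hom_cbvs (lreg A) M).

Lemma rgh_act_mhom (a : A) (g : mhom (lreg A) M) :
  @is_mhom R A (lreg A) M (fun x : A => g (bmul x a)).
Proof.
split.
  exact: (bl_comp (mhom_bl g) (bilinl a (bmul_bilinear A))).
by move=> b x /=; rewrite -bmulA; exact: mhomA.
Qed.

Definition rgh_act (a : A) (g : mhom (lreg A) M) : mhom (lreg A) M :=
  MHom (rgh_act_mhom a g).

Lemma rgh_act_bilinear : bounded_bilinear (rgh_act : A -> H -> H).
Proof.
have [lm rm hm] := bmul_bilinear A.
split.
- move=> g c a b; apply: mhomE => x.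
  by rewrite mhom_addE mhom_scaleE !MHomE rm (mhom_bl g).1.
- by move=> a c g h; apply: mhomE => x.
- move=> S F bS bF D bD.
  apply: (bounded_subset _ (bF _ (hm D S bD bS))).
  move=> _ [_ [a Sa [g Fg <-]] [x Dx <-]]; exists g => //.
  by exists (bmul x a) => //; exists x => //; exists a.
Qed.

Lemma rgh_actM a b (g : H) : rgh_act (bmul a b) g = rgh_act a (rgh_act b g).
Proof. by apply: mhomE => x; rewrite !MHomE bmulA. Qed.

Definition Rgh : bmod A := @BMod R A H rgh_act rgh_act_bilinear rgh_actM.
End Rgh.

Section MHomOps.
Variables (R : realType) (A : balg R).
Implicit Types M N P : bmod A.

Lemma mhom_id_subproof M : @is_mhom R A M M id.
Proof. by split => //; exact: bl_id. Qed.
Definition mhom_id M : mhom M M := MHom (mhom_id_subproof M).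

Lemma mhom_comp_subproof M N P (g : mhom N P) (h : mhom M N) :
  @is_mhom R A M P (g \o h).
Proof.
split; first exact: (bl_comp (mhom_bl g) (mhom_bl h)).
by move=> a m /=; rewrite !mhomA.
Qed.
Definition mhom_comp M N P (g : mhom N P) (h : mhom M N) : mhom M P :=
  MHom (mhom_comp_subproof g h).

Lemma ess_map_balanced M N (phi : mhom M N) :
  ess_balanced_mhom (fun a m => ess_pure a (phi m)).
Proof.
have [l r h] := bpure_bilinear (rreg A) N; split; last 2 first.
- by move=> x a m; rewrite mhomA; exact: (@bpure_balanced _ _ (rreg A) N).
- by move=> a x m; rewrite [RHS]ess_act_pure.
split.
- by move=> m; exact: l.
- by move=> a c m m'; rewrite (mhom_bl phi).1; exact: r.
- move=> S T bS bT.
  apply: (bounded_subset _ (h S _ bS ((mhom_bl phi).2 _ bT))).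
  by move=> _ [a Sa [m Tm <-]]; exists a => //; exists (phi m) => //; exists m.
Qed.

Definition Ess_map M N (phi : mhom M N) : mhom (Ess M) (Ess N) :=
  ess_lift (ess_map_balanced phi).

Lemma rgh_map_mhom M N (phi : mhom M N) :
  @is_mhom R A (Rgh M) (Rgh N) (fun g : mhom (lreg A) M => mhom_comp phi g).
Proof.
split; last by move=> a g; apply: mhomE => x.
split=> [c g h|F bF].
  apply: mhomE => x; rewrite mhom_addE mhom_scaleE !MHomE /=.
  by rewrite mhom_addE mhom_scaleE (mhom_bl phi).1.
move=> S bS; apply: (bounded_subset _ ((mhom_bl phi).2 _ (bF S bS))).
move=> _ [_ [g Fg <-] [x Sx <-]]; exists (mhom_fun g x) => //.
by exists g => //; exists x.
Qed.

Definition Rgh_map M N (phi : mhom M N) : mhom (Rgh M) (Rgh N) :=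
  MHom (rgh_map_mhom phi).
End MHomOps.

Section Change.
Variables (R : realType) (A B : balg R) (f : bhom A B).
Implicit Types M N : bmod B.

Lemma restr_map_mhom M N (phi : mhom M N) : @is_mhom R A (restr f M) (restr f N) phi.
Proof. by split; [exact: (mhom_bl phi)|move=> a m; exact: (mhomA phi)]. Qed.

Definition restr_map M N (phi : mhom M N) : mhom (restr f M) (restr f N) :=
  MHom (restr_map_mhom phi).

Lemma ess_compare_balanced M :
  @ess_balanced_mhom R A (restr f M) (restr f (Ess M))
    (fun a m => ess_pure (f a) (m : M)).
Proof.
have [l r h] := bpure_bilinear (rreg B) M; split; last 2 first.
- move=> x a m; rewrite bhomM; exact: (@bpure_balanced _ _ (rreg B) M).
- by move=> a x m; rewrite bhomM [RHS]ess_act_pure.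
split.
- by move=> m c a b; rewrite (bhom_bl f).1; exact: l.
- by move=> a; exact: r.
- move=> S T bS bT.
  apply: (bounded_subset _ (h _ T ((bhom_bl f).2 _ bS) bT)).
  by move=> _ [a Sa [m Tm <-]]; exists (f a); [exists a|exists m].
Qed.

Definition ess_compare M : mhom (Ess (restr f M)) (restr f (Ess M)) :=
  ess_lift (ess_compare_balanced M).

Lemma rgh_compare_elt M (g : mhom (lreg B) M) :
  @is_mhom R A (lreg A) (restr f M) (fun a : A => g (f a)).
Proof.
split; first exact: (bl_comp (mhom_bl g) (bhom_bl f)).
by move=> a x; rewrite /= bhomM; exact: mhomA.
Qed.

Lemma rgh_compare_mhom M :
  @is_mhom R A (restr f (Rgh M)) (Rgh (restr f M))
    (fun g : mhom (lreg B) M => MHom (rgh_compare_elt g)).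
Proof.
split; last by move=> a g; apply: mhomE => x; rewrite !MHomE bhomM.
split=> [c g h|F bF]; first by apply: mhomE => x.
move=> S bS; apply: (bounded_subset _ (bF _ ((bhom_bl f).2 _ bS))).
by move=> _ [_ [g Fg <-] [x Sx <-]]; exists g => //; exists (f x) => //; exists x.
Qed.

Definition rgh_compare M : mhom (restr f (Rgh M)) (Rgh (restr f M)) :=
  MHom (rgh_compare_mhom M).

Definition shriek M : bmod A := Ess (restr f (Rgh M)).

Definition shriek_map M N (phi : mhom M N) : mhom (shriek M) (shriek N) :=
  Ess_map (restr_map (Rgh_map phi)).

Lemma shriek_to_restr_balanced M :
  @ess_balanced_mhom R A (restr f (Rgh M)) (restr f M)
    (fun a (g : mhom (lreg B) M) => g (f a)).
Proof.
split; last 2 first.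
- by move=> x a g; rewrite bhomM.
- by move=> a x g; rewrite bhomM; exact: (mhomA g).
split.
- by move=> g c a b; rewrite (bhom_bl f).1 (mhom_bl g).1.
- by move=> a c g h.
- move=> S F bS bF; apply: (bounded_subset _ (bF _ ((bhom_bl f).2 _ bS))).
  by move=> _ [a Sa [g Fg <-]]; exists g => //; exists (f a) => //; exists a.
Qed.

(* Sends [a (x) g] to [g (f a)]: this is [Ess_map (rgh_compare f M)] followed by the
   evaluation of [Hom_A(A, -)]. *)
Definition shriek_to_restr M : mhom (shriek M) (restr f M) :=
  ess_lift (shriek_to_restr_balanced M).
End Change.

Record emod (R : realType) (A : balg R) := EMod {
  emod_bmod :> bmod A;
  emodP : essential emod_bmod }.

(* Functors defined on the essential [B]-modules, with values in all
   [A]-modules; essential modules form a full subcategory. *)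
Record mod_functor (R : realType) (B A : balg R) := ModFunctor {
  fobj :> emod B -> bmod A;
  fmap : forall M N : emod B, mhom M N -> mhom (fobj M) (fobj N);
  fmap_id : forall M : emod B, fmap (mhom_id M) = mhom_id (fobj M);
  fmap_comp : forall (M N P : emod B) (g : mhom N P) (h : mhom M N),
    fmap (mhom_comp g h) = mhom_comp (fmap g) (fmap h) }.

Definition essential_valued (R : realType) (B A : balg R) (F : mod_functor B A) :=
  forall M : emod B, essential (F M).

Definition natural_iso (R : realType) (B A : balg R) (F G : mod_functor B A)
    (theta : forall M : emod B, mhom (F M) (G M)) :=
  (forall M, born_iso (theta M)) /\
  (forall (M N : emod B) (phi : mhom M N),
     mhom_comp (theta N) (fmap F phi) = mhom_comp (fmap G phi) (theta M)).

Section Functors.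
Variables (R : realType) (A B : balg R) (f : bhom A B).

Lemma restr_map_id (M : emod B) : restr_map f (mhom_id M) = mhom_id (restr f M).
Proof. exact: mhomE. Qed.

Lemma restr_map_comp (M N P : emod B) (g : mhom N P) (h : mhom M N) :
  restr_map f (mhom_comp g h) = mhom_comp (restr_map f g) (restr_map f h).
Proof. exact: mhomE. Qed.

Definition restr_functor : mod_functor B A :=
  @ModFunctor R B A (fun M => restr f M) (fun M N => @restr_map R A B f M N)
    restr_map_id restr_map_comp.

Lemma shriek_map_id (M : emod B) : shriek_map f (mhom_id M) = mhom_id (shriek f M).
Proof.
apply: ess_ext => a g; rewrite ess_liftE [RHS]MHomE; congr ess_pure.
exact: mhomE.
Qed.

Lemma shriek_map_comp (M N P : emod B) (g : mhom N P) (h : mhom M N) :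
  shriek_map f (mhom_comp g h) = mhom_comp (shriek_map f g) (shriek_map f h).
Proof.
apply: ess_ext => a k.
rewrite -[RHS]/(shriek_map f g (shriek_map f h (ess_pure a k))) !ess_liftE.
by congr (ess_pure a _); exact: mhomE.
Qed.

Definition shriek_functor : mod_functor B A :=
  @ModFunctor R B A (fun M => shriek f M) (fun M N => @shriek_map R A B f M N)
    shriek_map_id shriek_map_comp.
End Functors.

(* Main.v *)
Require Import Defs.
From mathcomp Require Import all_boot reals.
From mathcomp Require Import ssralg all_classical.

(** All inverse maps are built from [B ~ A (x)_A B] and [B ~ B (x)_A A].
    The inverse of [A (x)_A M -> B (x)_B M] is [f(a) b (x) m |-> a (x) b m], and the
    inverse of [Hom_B(B, M) -> Hom_A(A, M)] sends [h] to [b f(a) |-> b h(a)].  They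
    are inverse to each other on products [a a'], and approximate units make the
    products dense in [A].  If [M] is essential over [B], then the composite of
    [A (x)_A M ~ B (x)_B M] with [B (x)_B M ~ M] shows that it is essential over [A],
    and [f(a) m |-> a (x) (x |-> x m)] inverts [f^! M -> f^* M]. *)

Set Implicit Arguments.
Unset Strict Implicit.
Unset Printing Implicit Defensive.
Local Open Scope classical_set_scope.
Local Open Scope ring_scope.

(** * Bornological isomorphisms, and spaces known to be balanced tensor products *)

Section BornIso.
Variable R : realType.
Implicit Types U V W : cbvs R.

Lemma born_iso_inv V W (phi : V -> W) : born_iso phi -> exists psi : W -> V,
  [/\ bounded_linear psi, cancel phi psi & cancel psi phi].
Proof. by case=> _ [psi [bpsi h1 h2]]; exists psi; split. Qed.

Lemma born_iso_comp U V W (psi : V -> W) (phi : U -> V) :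
  born_iso psi -> born_iso phi -> born_iso (psi \o phi).
Proof.
move=> [bpsi [psi' [bpsi' h1 h2]]] [bphi [phi' [bphi' k1 k2]]].
split; first exact: bl_comp.
exists (phi' \o psi'); split; first exact: bl_comp.
- by move=> x /=; rewrite h1 k1.
- by move=> x /=; rewrite k2 h2.
Qed.
End BornIso.

Section TensorFamily.
Variables (R : realType) (A : balg R) (P : rbmod A) (N : bmod A).
Variables (E : cbvs R) (iota : btens P N -> E).
Hypothesis iso_iota : born_iso iota.

Lemma born_iso_btens_ext (Y : cbvs R) (phi psi : E -> Y) :
  bounded_linear phi -> bounded_linear psi ->
  (forall p n, phi (iota (bpure p n)) = psi (iota (bpure p n))) -> phi =1 psi.
Proof.
move=> bphi bpsi h e; have [sigma [_ _ k]] := born_iso_inv iso_iota.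
rewrite -(k e); have bi := iso_iota.1.
exact: (btens_ext (bl_comp bphi bi) (bl_comp bpsi bi)).
Qed.

(** In both uses [E] is [B], and the parameter [x] is an element of [M] or a homomorphism from [A]
    to [M]. Joint boundedness in [x] and [e] later bounds the inverse maps. *)
Lemma born_iso_btens_family (X Y : cbvs R) (beta : X -> P -> N -> Y) :
  (forall x, balanced (beta x)) ->
  (forall p n, linear (fun x => beta x p n)) ->
  (forall D S T, bounded D -> bounded S -> bounded T ->
     bounded [set y | exists x p n, [/\ D x, S p, T n & y = beta x p n]]) ->
  exists Phi : X -> E -> Y, bounded_bilinear Phi /\
    forall x p n, Phi x (iota (bpure p n)) = beta x p n.
Proof.
move=> bal lin bnd; have [sigma [bsigma k1 k2]] := born_iso_inv iso_iota.
pose L x := btens_lift (bal x).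
have bL x : bounded_linear (L x) by exact: btens_lift_bl.
have LE x p n : L x (bpure p n) = beta x p n by exact: btens_liftE.
exists (fun x e => L x (sigma e)); split; last by move=> x p n; rewrite k1.
split=> [e c x y|x|D F bD bF].
- apply: (btens_ext (bL _) (bl_lincomb c (bL x) (bL y))) => p n.
  by rewrite !LE lin.
- exact: (bl_comp (bL x) bsigma).1.
(* [S], [T] and [c] depend on [F] only, so one disk [T0] serves all [L x] with [x] in [D]. *)
- have [S [T [c [bS bT hb]]]] := btens_bound (bsigma.2 _ bF).
  have [T0 [bT0 dT0 hT0]] := bnd_disk (bnd _ _ _ bD bS bT).
  apply: (bounded_subset _ (bnd_dil c bT0)) => _ [x Dx [e Fe <-]].
  apply: (hb _ _ _ (bL x) bT0 dT0); last by exists e.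
  by move=> p n Sp Tn; rewrite LE; apply: hT0; exists x, p, n.
Qed.
End TensorFamily.

(** * Density of products *)

Section ApproximateUnits.
Variables (R : realType) (A : balg R) (uA : has_approx_units A).

(** Approximate units for the single point [x] give [u_n x -> x], and limits are unique. *)
Lemma approx_units_ext (Y : cbvs R) (phi psi : A -> Y) :
  bounded_linear phi -> bounded_linear psi ->
  (forall a b, phi (bmul a b) = psi (bmul a b)) -> phi =1 psi.
Proof.
move=> bphi bpsi h x.
have [u [T [bT dT uT]]] := uA (bounded_set1 x).
have ux : born_cvg (fun n => bmul (u n) x) x.
  exists T; split => // e e0; have [n0 h0] := uT e e0.
  by exists n0 => n nn; case: (h0 n nn x erefl).
apply: (born_cvg_uniq (born_cvg_map bphi ux)).
rewrite (_ : phi \o _ = psi \o (fun n => bmul (u n) x)).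
  exact: born_cvg_map.
by apply/funext => n /=.
Qed.

Lemma ess_approx_units_ext (M : bmod A) (Y : cbvs R) (phi psi : Ess M -> Y) :
  bounded_linear phi -> bounded_linear psi ->
  (forall a b m, phi (ess_pure (bmul a b) m) = psi (ess_pure (bmul a b) m)) ->
  phi =1 psi.
Proof.
move=> bphi bpsi h; apply: (btens_ext bphi bpsi) => a m.
have bp := bilinl m (bpure_bilinear (rreg A) M).
apply: (approx_units_ext (bl_comp bphi bp) (bl_comp bpsi bp)) => b c; exact: h.
Qed.
End ApproximateUnits.

Lemma ress_counitE (R : realType) (A : balg R) (M : rbmod A) (m : M) (a : A) :
  @ress_counit R A M (bpure m (a : lreg A)) = ract m a.
Proof. exact: btens_liftE. Qed.

(** * The two comparison maps along a proper morphism *)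

Section ProperMorphism.
Variables (R : realType) (A B : balg R) (f : bhom A B).
Hypotheses (uA : has_approx_units A) (pf : proper_morphism f).

(** For fixed [m], [A (x)_A B ~ B] turns [(a, b) |-> a (x) b m] into a map on [B]; being jointly
    bounded in [m] and balanced over [B], it descends to [B (x)_B M]. *)
Lemma proper_ess_lift (M : bmod B) :
  exists Phi : Ess M -> Ess (restr f M), bounded_linear Phi /\
    forall a b m, Phi (ess_pure (bmul (f a) b) m) =
                  ess_pure a (lact b m : restr f M).
Proof.
have [l r h] := bpure_bilinear (rreg A) (restr f M).
have [la ra ha] := lact_bilinear M.
have iso := pf.1.
pose beta (m : M) (a : rreg A) (b : restr f (lreg B)) : Ess (restr f M) :=
  @ess_pure R A (restr f M) a (lact (b : B) m).
have [x|a b c m m'|D S T bD bS bT|Phi [bPhi PhiE]] :=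
    born_iso_btens_family iso (beta := beta).
- split; last first.
    move=> a a' b; rewrite /beta /ess_pure bpure_balanced; congr bpure.
    exact: (esym (lactM (f a') (b : B) x)).
  split=> [b c a a'|a c b b'|S T bS bT]; first exact: l.
    by rewrite /beta la; exact: r.
  apply: (bounded_subset _ (h _ _ bS (ha _ _ bT (bounded_set1 x)))).
  move=> _ [a Sa [b Tb <-]]; exists a => //; exists (lact (b : B) x) => //.
  by exists b => //; exists x.
- by rewrite /beta ra; exact: r.
- apply: (bounded_subset _ (h _ _ bS (ha _ _ bT bD))).
  move=> _ [m [a [b [Dm Sa Tb ->]]]]; exists a => //.
  by exists (lact (b : B) m) => //; exists b => //; exists m.
have {}PhiE m a b : Phi m (bmul (f a) b) = ess_pure a (lact b m : restr f M).
  by rewrite -[RHS]PhiE; congr (Phi m _); rewrite ess_liftE.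
have bal : balanced (M := rreg B) (N := M) (fun b m => Phi m b).
  have [lP rP hP] := bPhi; split.
    split=> [m|b|S T bS bT]; [exact: rP|exact: lP|].
    apply: (bounded_subset _ (hP _ _ bT bS)) => _ [b Sb [m Tm <-]].
    by exists m => //; exists b.
  move=> b b' m.
  (* It suffices to test [f(a) c] in [B]: both sides give [a (x) c b' m]. *)
  apply: (born_iso_btens_ext iso (phi := fun b => Phi m (bmul b b'))
    (psi := Phi (lact b' m))).
  - exact: (bl_comp (bilinr m bPhi) (bilinl b' (bmul_bilinear B))).
  - exact: bilinr bPhi.
  - move=> a b''; rewrite !ess_liftE /= /restr_act /=.
    by rewrite -bmulA !PhiE lactM.
exists (btens_lift bal); split; first exact: btens_lift_bl.
by move=> a b m; rewrite btens_liftE PhiE.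
Qed.

Lemma ess_compare_iso (M : bmod B) : born_iso (ess_compare f M).
Proof.
have [Phi [bPhi PhiE]] := proper_ess_lift M.
have bc := mhom_bl (ess_compare f M).
split => //; exists Phi; split => //.
(* [Phi] is explicit only on [f(a) b (x) m], hence the passage to products: [f(a) f(b) (x) m] goes
   to [a (x) f(b) m = a b (x) m]. *)
- apply: (ess_approx_units_ext uA (bl_comp bPhi bc) (bl_id _)) => a b m /=.
  rewrite ess_liftE bhomM PhiE; symmetry.
  exact: (bpure_balanced (M := rreg A) (N := restr f M)).
- apply: (btens_ext (bl_comp bc bPhi) (bl_id _)) => b m.
  have bp := bilinl m (bpure_bilinear (rreg B) M).
  apply: (born_iso_btens_ext pf.1 (bl_comp (bl_comp bc bPhi) bp) bp) => a b'.
  rewrite /= ess_liftE /= /restr_act /= PhiE ess_liftE; symmetry.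
  exact: (bpure_balanced (M := rreg B) (N := M)).
Qed.

Lemma essential_restr (M : bmod B) : essential M -> essential (restr f M).
Proof.
move=> eM; have := born_iso_comp eM (ess_compare_iso M).
(* The composite is the counit over [A]: both send [a (x) m] to [f(a) m]. *)
congr born_iso; apply/funext.
apply: (btens_ext (bl_comp (mhom_bl (ess_counit M)) (mhom_bl (ess_compare f M)))
  (mhom_bl (ess_counit (restr f M)))) => a m /=.
by rewrite !ess_liftE.
Qed.

(** The right-hand half of properness, [B (x)_A A ~ B], extends [(b, a) |-> b g(a)] to [B], with [g]
    as the parameter of the family. *)
Lemma rgh_compare_iso (M : bmod B) : born_iso (rgh_compare f M).
Proof.
have [l r h] := lact_bilinear M.
have iso := pf.2.
pose beta (g : Rgh (restr f M)) (b : restr (op_bhom f) (rreg B)) (a : lreg A) : M :=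
  lact (b : B) (mhom_fun g a : M).
have [g|b a c g g'|D S T bD bS bT|Phi [bPhi PhiE]] :=
    born_iso_btens_family iso (beta := beta).
- split; last first.
    by move=> b a a'; rewrite /beta mhomA /= /restr_act -lactM.
  split=> [a c b b'|b c a a'|S T bS bT]; first exact: l.
    by rewrite /beta (mhom_bl g).1 r.
  apply: (bounded_subset _ (h _ _ bS ((mhom_bl g).2 _ bT))).
  move=> _ [b Sb [a Ta <-]]; exists b => //; exists (mhom_fun g a) => //.
- by rewrite /beta mhom_addE mhom_scaleE r.
- apply: (bounded_subset _ (h _ _ bS (bD _ bT))).
  move=> _ [g [b [a [Dg Sb Ta ->]]]]; exists b => //; exists (mhom_fun g a) => //.
  by exists g => //; exists a.
have {}PhiE g b a : Phi g (bmul b (f a)) = lact b (mhom_fun g a : M).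
  by rewrite -[RHS]PhiE; congr (Phi g _); rewrite ress_counitE.
have PhiP g : @is_mhom R B (lreg B) M (Phi g).
  split; first exact: bilinr bPhi.
  move=> b b'.
  (* At [c f(a)] both sides are [b c g(a)]. *)
  apply: (born_iso_btens_ext iso (phi := fun b' => Phi g (bmul b b'))
    (psi := fun b' => lact b (Phi g b'))).
  - exact: (bl_comp (bilinr g bPhi) (bilinr b (bmul_bilinear B))).
  - exact: (bl_comp (bilinr b (lact_bilinear M)) (bilinr g bPhi)).
  - move=> b'' a; rewrite ress_counitE /ract /= /restr_act /= /op_mul.
    by rewrite bmulA !PhiE lactM.
split; first exact: mhom_bl.
exists (fun g => MHom (PhiP g)); split.
- split=> [c g g'|D bD S bS].
    apply: mhomE => b; rewrite mhom_addE mhom_scaleE !MHomE.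
    by have [lP _ _] := bPhi; exact: lP.
  (* Equiboundedness of the image of [D] is joint boundedness of [Phi] on [D] and [S]. *)
  have [_ _ hP] := bPhi.
  apply: (bounded_subset _ (hP _ _ bD bS)).
  by move=> _ [_ [g Dg <-] [b Sb <-]]; exists g => //; exists b.
- move=> g; apply: mhomE => b; rewrite MHomE.
  apply: (born_iso_btens_ext iso (bilinr _ bPhi) (mhom_bl (g : mhom _ _))).
  move=> b' a; rewrite ress_counitE /ract /= /restr_act /= /op_mul PhiE !MHomE.
  by rewrite -(mhomA (g : mhom _ _)).
- move=> g; apply: mhomE => a; rewrite !MHomE.
  (* On products, [f(a1) f(a2)] goes to [f(a1) g(a2)], which is [g(a1 a2)] by [A]-linearity. *)
  apply: (approx_units_ext uA (bl_comp (bilinr g bPhi) (bhom_bl f))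
    (mhom_bl (g : mhom _ _))) => a1 a2 /=.
  by rewrite bhomM PhiE -[bmul a1 a2]/(@lact _ _ (lreg A) a1 a2) mhomA.
Qed.
End ProperMorphism.

(** * The comparison of [f^!] with [f^*] *)

Section RghUnit.
Variables (R : realType) (A : balg R) (M : bmod A).

Lemma rgh_unit_elt (m : M) : @is_mhom R A (lreg A) M (fun a : A => lact a m).
Proof.
split; first exact: (bilinl m (lact_bilinear M)).
by move=> a b; exact: lactM.
Qed.

Lemma rgh_unit_mhom : @is_mhom R A M (Rgh M) (fun m => MHom (rgh_unit_elt m)).
Proof.
have [l r h] := lact_bilinear M.
split; last by move=> a m; apply: mhomE => x; rewrite !MHomE lactM.
split=> [c m m'|D bD S bS].
  by apply: mhomE => x; rewrite mhom_addE mhom_scaleE !MHomE r.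
apply: (bounded_subset _ (h _ _ bS bD)).
by move=> _ [_ [m Dm <-] [a Sa <-]]; exists a => //; exists m.
Qed.

Definition rgh_unit : mhom M (Rgh M) := MHom rgh_unit_mhom.
End RghUnit.

(** The bounded inverse is automatically [A]-linear, so [Ess_map] applies to it. *)
Lemma Ess_map_iso (R : realType) (A : balg R) (M N : bmod A) (phi : mhom M N) :
  born_iso phi -> born_iso (Ess_map phi).
Proof.
move=> /born_iso_inv[psi [bpsi k1 k2]].
have psiP : is_mhom psi.
  by split => // a n; rewrite -{1}(k2 n) -mhomA k1.
split; first exact: mhom_bl.
exists (Ess_map (MHom psiP)); split; first exact: mhom_bl.
- apply: (btens_ext (bl_comp (mhom_bl (Ess_map (MHom psiP)))
    (mhom_bl (Ess_map phi))) (bl_id _)) => a m /=.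
  by rewrite !ess_liftE MHomE k1.
- apply: (btens_ext (bl_comp (mhom_bl (Ess_map phi))
    (mhom_bl (Ess_map (MHom psiP)))) (bl_id _)) => a n /=.
  by rewrite !ess_liftE MHomE k2.
Qed.

(** By naturality, the counit of [M] is [Ess_map phi], then the counit of [N], then the inverse of
    [phi]. *)
Lemma essential_iso (R : realType) (A : balg R) (M N : bmod A) (phi : mhom M N) :
  born_iso phi -> essential N -> essential M.
Proof.
move=> iphi eN; have [bphi [psi [bpsi k1 k2]]] := iphi.
have ipsi : born_iso psi by split => //; exists phi.
have := born_iso_comp ipsi (born_iso_comp eN (Ess_map_iso iphi)).
congr born_iso; apply/funext => t /=; rewrite -[RHS]k1; congr psi.
apply: (btens_ext (bl_comp (mhom_bl (ess_counit N)) (mhom_bl (Ess_map phi)))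
  (bl_comp bphi (mhom_bl (ess_counit M)))) => a m /=.
by rewrite !ess_liftE mhomA.
Qed.

Lemma shriek_to_restr_iso (R : realType) (A B : balg R) (f : bhom A B) (M : bmod B) :
  has_approx_units A -> essential (restr f M) -> born_iso (shriek_to_restr f M).
Proof.
move=> uA eM; have [sigma [bsigma k1 k2]] := born_iso_inv eM.
have bt := mhom_bl (shriek_to_restr f M).
set U := Ess_map (restr_map f (rgh_unit M)).
have bU : bounded_linear (U \o sigma) by exact: (bl_comp (mhom_bl U) bsigma).
have UE a (m : restr f M) : U (sigma (lact a m)) =
    ess_pure a (rgh_unit M (m : M) : restr f (Rgh M)).
  have -> : lact a m = ess_counit (restr f M) (ess_pure a m) by rewrite ess_liftE.
  by rewrite k1 ess_liftE.
split => //; exists (U \o sigma); split => //.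
(* [a b (x) g] goes to [f(a) g(f(b))], then to [a (x) (x |-> x g(f(b)))]. As
   [x g(f(b)) = g(x f(b))], the second factor is [b] acting on [g]. *)
- apply: (ess_approx_units_ext uA (bl_comp bU bt) (bl_id _)) => a b g /=.
  rewrite ess_liftE bhomM -[bmul (f a) _]/(@lact _ _ (lreg B) (f a) (f b)) mhomA.
  rewrite -[lact (f a) _]/(@lact _ _ (restr f M) a _) UE.
  rewrite [RHS](bpure_balanced (M := rreg A) (N := restr f (Rgh M))).
  rewrite /ess_pure; congr (@bpure R A (rreg A) (restr f (Rgh M)) a _).
  by apply: mhomE => x; rewrite !MHomE -(mhomA (g : mhom _ _)).
- apply: (born_iso_btens_ext eM (bl_comp bt bU) (bl_id _)) => a m.
  by rewrite /= ess_liftE UE ess_liftE.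
Qed.

Theorem proposition31 (R : realType) (A B : balg R) (f : bhom A B)
    (qA : quasi_unital A) (qB : quasi_unital B) (pf : proper_morphism f) :
  [/\ forall M : bmod B, born_iso (ess_compare f M),
      forall M : bmod B, born_iso (rgh_compare f M)
    & [/\ essential_valued (shriek_functor f),
          essential_valued (restr_functor f)
        & natural_iso (F := shriek_functor f) (G := restr_functor f)
            (fun M => shriek_to_restr f M)]].
Proof.
have [uA _ _] := qA.
have eM (M : emod B) : essential (restr f M).
  exact: (essential_restr uA pf (emodP M)).
have iM (M : emod B) : born_iso (shriek_to_restr f M).
  exact: (shriek_to_restr_iso uA (eM M)).
split; [exact: ess_compare_iso|exact: rgh_compare_iso|].
(* Essentiality of [f^! M] is transported from [f^* M] along the isomorphism. *)
split => // [M|]; first exact: (essential_iso (iM M) (eM M)).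
(* Naturality: both composites send [a (x) g] to [phi(g(f(a)))]. *)
split => // M N phi; apply: (@ess_ext R A (restr f (Rgh M))) => a g.
by rewrite !MHomE /= !ess_liftE !MHomE.
Qed.
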